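(* Let $\mathcal{S} = \{(p',q') \in [0,1]^{2} : 0 < p'+q' \leqslant 1\}$. For all $(p,q)\in\mathcal{S}$, each of the PCAs $G_{p,q}$ and $\widehat{G}_{p,q}$ is ergodic, and the probability of draw in the percolation game V4 on $\mathbb{Z}^2$ with parameters $p$ and $q$, in which $\mathrm{Out}(x,y) = \{(x-1,y+1), (x,y+1), (x+1,y+1)\}$ for each $(x,y)\in\mathbb{Z}^2$, is $0$.
   Context: A (one-dimensional) probabilistic cellular automaton (PCA) $F$ with finite alphabet $\mathcal{A}$, neighbourhood $\mathcal{N}=\{y_1,\dots,y_m\}\subset\mathbb{Z}$ and stochastic matrix $\varphi:\mathcal{A}^{m}\times\mathcal{A}\to[0,1]$ acts on configurations $\eta\in\mathcal{A}^{\mathbb{Z}}$ as follows: given $\eta$, the random configuration $F\eta\in\mathcal{A}^{\mathbb{Z}}$ has independent coordinates, with $\mathbf{P}[F\eta(x)=b]=\varphi(\eta(x+y_1),\dots,\eta(x+y_m),b)$ for $x\in\mathbb{Z}$, $b\in\mathcal{A}$. If $\eta$ is random with law $\mu$ (a probability measure on $\mathcal{A}^{\mathbb{Z}}$ with the $\sigma$-field generated by cylinder sets), $F\mu$ denotes the law of $F\eta$, and $F^{t}\mu=F(F^{t-1}\mu)$. A measure $\mu$ is stationary for $F$ if $F\mu=\mu$. The PCA $F$ is ergodic if it has a unique stationary measure $\mu$ and, for every probability measure $\nu$ on $\mathcal{A}^{\mathbb{Z}}$, $F^{t}\nu$ converges weakly to $\mu$ as $t\to\infty$. The PCA $G_{p,q}$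 has alphabet $\{0,1\}$, neighbourhood $\{-1,0,1\}$ (i.e. the update at $n$ uses $\eta(n-1),\eta(n),\eta(n+1)$) and stochastic matrix $\varphi_{p,q}$ given by $\varphi_{p,q}(0,0,0,0)=p$, $\varphi_{p,q}(0,0,0,1)=1-p$, and $\varphi_{p,q}(a_0,a_1,a_2,0)=1-q$, $\varphi_{p,q}(a_0,a_1,a_2,1)=q$ for all $(a_0,a_1,a_2)\in\{0,1\}^3\setminus\{(0,0,0)\}$. The PCA $\widehat{G}_{p,q}$ has alphabet $\hat{\mathcal{A}}=\{0,?,1\}$ (three symbols), neighbourhood $\{-1,0,1\}$ and stochastic matrix $\widehat{\varphi}_{p,q}$ such that: - $\widehat{\varphi}_{p,q}(0,0,0,\cdot)$ gives mass $p$ to $0$ and $1-p$ to $1$; - for $(a_0,a_1,a_2)\in\hat{\mathcal{A}}^3\setminus\{0,?\}^3$, $\widehat{\varphi}_{p,q}(a_0,a_1,a_2,\cdot)$ gives mass $1-q$ to $0$ and $q$ to $1$; - for $(a_0,a_1,a_2)\in\{0,?\}^3\setminus\{(0,0,0)\}$, $\widehat{\varphi}_{p,q}(a_0,a_1,a_2,\cdot)$ gives mass $p$ to $0$, $q$ to $1$ and $r=1-p-q$ to $?$. Percolation game with parameters $p,q$ and move sets $\mathrm{Out}(x,y)$: each vertex of $\mathbb{Z}^{2}$ is independently assigned a random label, namely ''trap'' with probability $p$, ''target'' with probability $q$, and ''open'' with probability $r = 1-p-q$. After the labels are revealed to both players, a token is placed at an initial vertex, and two players take turns moving it; a move relocates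 the token from its current position $(x,y)$ to any vertex of $\mathrm{Out}(x,y)$. A player who moves the token to a trap loses immediately, and a player who moves the token to a target wins immediately. If the token never lands on a trap or a target, the game continues forever. For a given labeling, a player wins the game from a given initial vertex if she has a strategy that makes her win (in finitely many moves) against every strategy of the opponent. An initial vertex is in class $W$ if the player who moves first wins, in class $L$ if the player who moves first loses (i.e. the other player wins), and in class $D$ (draw) if neither player has a winning strategy. By convention, if the initial vertex itself is a trap it is placed in $W$, and if it is a target it is placed in $L$. The probability of draw is the probability (over the random labeling) that the initial vertex is in class $D$; by translation invariance it does not depend on the initial vertex, which may be taken to be the origin. *)

(* Defs.v *)
From HB Require Import structures.
From mathcomp Require Import all_boot all_order all_algebra.
From mathcomp Require Import all_classical all_reals all_analysis.
Import Order.TTheory GRing.Theory Num.Theory.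
Import numFieldNormedType.Exports.

Set Implicit Arguments.
Unset Strict Implicit.
Unset Printing Implicit Defensive.

Local Open Scope classical_set_scope.
Local Open Scope ring_scope.

(* A measurableType must be inhabited, hence the distinguished letter. *)
#[short(type="alphabetType")]
HB.structure Definition Alphabet := {A of Finite A & isPointed A}.

HB.instance Definition _ := Pointed.on bool.
HB.instance Definition _ := Pointed.on (option bool).

Definition coordinate_events (I : Type) (A : alphabetType) : set (set (I -> A)) :=
  [set B | exists (i : I) (a : A), B = [set eta | eta i = a]].

(* The configurations A^I, with the sigma-algebra generated by cylinders. *)
Definition config (I : Type) (A : alphabetType) : Type :=
  g_sigma_algebraType (@coordinate_events I A).

(* Under m the coordinates are independent, and coordinate i has the
   probability mass function w i. *)
Definition has_product_law (R : realType) (I : choiceType) (A : alphabetType)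
    (w : I -> A -> R) (m : set (config I A) -> \bar R) : Prop :=
  forall (s : seq I) (a : I -> A), uniq s ->
    m [set eta : config I A | forall i, i \in s -> eta i = a i] =
    (\prod_(i <- s) w i (a i))%:E.

Section PCA.
Variable R : realType.

Record pca := Pca {
  alphabet : alphabetType ;
  nbh_size : nat ;
  neighbourhood : nbh_size.-tuple int ;
  rule : nbh_size.-tuple alphabet -> alphabet -> R }.

Variable F : pca.

Local Notation A := (alphabet F).
Local Notation configZ := (config int A).

Definition window (eta : configZ) (x : int) : (nbh_size F).-tuple A :=
  [tuple eta (x + tnth (neighbourhood F) i) | i < nbh_size F].

(* nu = F mu, where K eta is the law of F eta. Such a K exists by
   Kolmogorov's extension theorem, and both K and nu are uniquely determined
   on measurable sets. *)
Definition is_image (mu nu : probability configZ R) : Prop :=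
  exists K : R.-pker configZ ~> configZ,
    (forall eta, has_product_law (fun x => rule (window eta x)) (K eta)) /\
    (forall B, measurable B -> nu B = (\int[mu]_eta K eta B)%E).

Definition stationary (mu : probability configZ R) : Prop := is_image mu mu.

(* A carries the discrete topology and A^Z the product topology. *)
Definition cvg_weakly (nu : nat -> probability configZ R)
    (mu : probability configZ R) : Prop :=
  forall f : {ptws int -> discrete_topology A} -> R,
    continuous f -> (exists M, forall eta, `|f eta| <= M) ->
    (\int[nu t]_eta (f eta)%:E)%E @[t --> \oo] --> (\int[mu]_eta (f eta)%:E)%E.

(* The sequence nus below is t |-> F^t nu. *)
Definition ergodic : Prop :=
  exists mu : probability configZ R,
    [/\ stationary mu,
        forall mu' : probability configZ R, stationary mu' ->
          forall B, measurable B -> mu' B = mu B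
      & forall nu : probability configZ R,
          exists nus : nat -> probability configZ R,
            [/\ nus 0%N = nu,
                forall t, is_image (nus t) (nus t.+1)
              & cvg_weakly nus mu]].

End PCA.

(* The letters 0 and 1 are false and true. *)
Definition G (R : realType) (p q : R) : pca R :=
  @Pca R bool 3 [tuple -1; 0; 1] (fun a b =>
    if a == [tuple false; false; false] then (if b then 1 - p else p)
    else (if b then q else 1 - q)).

(* The letters 0, ? and 1 are Some false, None and Some true. *)
Definition Ghat (R : realType) (p q : R) : pca R :=
  @Pca R (option bool) 3 [tuple -1; 0; 1] (fun a b =>
    if a == [tuple Some false; Some false; Some false] then
      match b with Some false => p | Some true => 1 - p | None => 0 end
    else if Some true \in a then
      match b with Some false => 1 - q | Some true => q | None => 0 end
    else
      match b with Some false => p | Some true => q | None => 1 - p - q end).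

Inductive label := Trap | Target | Open.

Definition label_encode (l : label) : option bool :=
  match l with Trap => Some false | Target => Some true | Open => None end.
Definition label_decode (o : option bool) : label :=
  match o with Some false => Trap | Some true => Target | None => Open end.
Lemma label_encodeK : cancel label_encode label_decode.
Proof. by case. Qed.

HB.instance Definition _ := Finite.copy label (can_type label_encodeK).
HB.instance Definition _ := isPointed.Build label Open.

Definition vertex : choiceType := (int * int)%type.

Definition labeling := config vertex label.

Definition label_mass (R : realType) (p q : R) (l : label) : R :=
  match l with Trap => p | Target => q | Open => 1 - p - q end.

Section Game.
Variable Out : vertex -> seq vertex.
Variable lab : labeling.

(* A strategy maps the current position and the list of the earlier positions,
   latest first, to the next position. *)
Definition strategy := vertex -> seq vertex -> vertex.

Definition legal (s : strategy) : Prop := forall v past, s v past \in Out v.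

(* Player false moves first. Both players' moves are numbered from 0, so that
   move number n, from position n to position n.+1, is made by odd n. *)
Fixpoint play (s : bool -> strategy) (v : vertex) (n : nat) :
    vertex * seq vertex :=
  if n is m.+1 then
    let: (u, past) := play s v m in (s (odd m) u past, u :: past)
  else (v, [::]).

Definition position (s : bool -> strategy) (v : vertex) (n : nat) : vertex :=
  (play s v n).1.

Definition winning_label (w mover : bool) : label :=
  if mover == w then Target else Trap.

(* The play is decided at the first position other than the initial one whose
   label is not Open. *)
Definition play_won (w : bool) (s : bool -> strategy) (v : vertex) : Prop :=
  exists n : nat,
    (forall k, (0 < k <= n)%N -> lab (position s v k) = Open) /\
    lab (position s v n.+1) = winning_label w (odd n).

Definition player_wins (w : bool) (v : vertex) : Prop :=
  exists sw : strategy, legal sw /\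
    forall so : strategy, legal so ->
      play_won w (fun i => if i == w then sw else so) v.

Definition class_W (v : vertex) : Prop :=
  lab v = Trap \/ (lab v = Open /\ player_wins false v).

Definition class_L (v : vertex) : Prop :=
  lab v = Target \/ (lab v = Open /\ player_wins true v).

Definition class_D (v : vertex) : Prop := ~ class_W v /\ ~ class_L v.

End Game.

Definition Out_V4 (v : vertex) : seq vertex :=
  [:: (v.1 - 1, v.2 + 1); (v.1, v.2 + 1); (v.1 + 1, v.2 + 1)].

(* Main.v *)
(** Both PCAs are driven by i.i.d. labels (trap, target, open): a trap produces 0,
    a target produces 1 and an open site produces the NOR of its three
    neighbours, where NOR is evaluated in three-valued logic for the second PCA.
    Evaluating the three-valued recursion from [?] everywhere, a decided letter is
    never revised, and it is the letter produced by every other initial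
    configuration. So everything follows once the probability [m_t] of [?]
    after [t] steps tends to 0: a vertex is a draw exactly when it stays [?] for
    ever, and two trajectories with the same labels differ in a window of width [k]
    with probability at most [k m_t].

    The decay is shown by a weight function. With [r = 1 - p - q] and
    [g = r - p^2], the combination
    [[?] + 2 [0?] + 2 [00?] - 2 g [000?] - [?0?] - 2 [?00?]]
    of word probabilities decreases by at least [(p + q)^3 / 32 * [?]] in each
    step, for every law invariant under translations and reflection. At
    [p = q = 0] it is the total length of the maximal blocks of [?] plus the
    number of sites that their two ends are about to gain; the factor [g] balances
    the gains and losses caused by the noise up to the second order in [p]. *)

Require Import Defs.
From HB Require Import structures.
From mathcomp Require Import all_boot all_order all_algebra.
From mathcomp Require Import all_classical all_reals all_analysis.
From mathcomp Require Import measurable_realfun zify ring lra.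
Import Order.TTheory GRing.Theory Num.Theory.
Import numFieldNormedType.Exports.

Set Implicit Arguments.
Unset Strict Implicit.
Unset Printing Implicit Defensive.

Local Open Scope classical_set_scope.
Local Open Scope ring_scope.

(** * Finite-valued random variables and product laws *)

(** Monotonicity in t of the probability u_t of ? costs nothing, since the start ? everywhere
    carries the least information, but it gives no rate. The weight supplies one: it stays between
    -5 and 7, so summing its losses gives t kappa u_t <= 12. The obstacle is small noise. Deep
    inside a long block without 1 the gains and losses of the weight cancel through second order:
    for q = 0 the coefficient left there to pay for kappa is p^3 - 2 p^4 + 2 p^6, which is why kappa
    is cubic. With so little room the decrease is proved by an explicit certificate: the loss is
    expressed through a few nonnegative slacks whose coefficients are polynomials that are
    nonnegative on the triangle p, q, r >= 0. The labels are attached to the vertices of the plane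
    once and for all, and the value at a fixed vertex is computed from an initial row that recedes
    as t grows. This gives the monotonicity, makes the stationary law a pathwise limit, and is at
    the same time the analysis of the game tree cut at depth t. *)

Section FiniteValued.
Context d (X : measurableType d).

(** Stated on fibres, so that the finite target needs no sigma-algebra of its own. *)
Definition fin_measurable (A : Type) (f : X -> A) :=
  forall a, measurable [set x | f x = a].

Lemma fin_measurable_pred (A : finType) (f : X -> A) (Q : A -> Prop) :
  fin_measurable f -> measurable [set x | Q (f x)].
Proof.
move=> mf; rewrite (_ : [set x | _] = \bigcup_(a in Q) [set x | f x = a]).
  by apply: fin_bigcup_measurable => [|a _]; [exact: finite_finset|exact: mf].
by apply/seteqP; split=> x /= => [Qf|[a Qa ->]//]; exists (f x).
Qed.

Lemma fin_measurable_comp (A : finType) (B : Type) (h : A -> B) (f : X -> A) :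
  fin_measurable f -> fin_measurable (fun x => h (f x)).
Proof. by move=> mf b; exact: (@fin_measurable_pred A f (fun a => h a = b)). Qed.

Lemma fin_measurable_cst (A : Type) (a : A) : fin_measurable (fun=> a).
Proof.
move=> b; have [ab|ab] := pselect (a = b).
  by rewrite (_ : [set _ | _] = setT)//; apply/seteqP; split.
by rewrite (_ : [set _ | _] = set0)//; apply/seteqP; split.
Qed.

Lemma fin_measurable_pair (A B : Type) (f : X -> A) (g : X -> B) :
  fin_measurable f -> fin_measurable g -> fin_measurable (fun x => (f x, g x)).
Proof.
move=> mf mg [a b].
rewrite (_ : [set x | _] = [set x | f x = a] `&` [set x | g x = b]).
  exact: measurableI.
by apply/seteqP; split=> x /= => [[-> ->]//|[-> ->]].
Qed.

Lemma fin_measurable_ffun (I : finType) (A : Type) (f : I -> X -> A) :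
  (forall i, fin_measurable (f i)) -> fin_measurable (fun x => [ffun i => f i x]).
Proof.
move=> mf u.
rewrite (_ : [set x | _] = \bigcap_(i in [set: I]) [set x | f i x = u i]).
  by apply: fin_bigcap_measurable => [|i _]; [exact: finite_finset|exact: mf].
apply/seteqP; split=> x /= => [fu i _|fu]; first by rewrite -fu ffunE.
by apply/ffunP => i; rewrite ffunE fu.
Qed.
End FiniteValued.

Section Configurations.
Variables (I : choiceType) (A : alphabetType).

Lemma fin_measurable_coord (i : I) : fin_measurable (fun eta : config I A => eta i).
Proof. by move=> a; apply: sub_sigma_algebra; exists i, a. Qed.

Lemma measurable_config d (X : measurableType d) (f : X -> config I A) :
  (forall i, fin_measurable (fun x => f x i)) -> measurable_fun setT f.
Proof.
move=> mf; refine (@measurability _ _ X _ setT f (@coordinate_events I A) erefl _).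
by move=> _ [_ [i [a ->]] <-]; rewrite setTI; exact: mf.
Qed.
End Configurations.

Lemma fin_measurable_fun d d' (X : measurableType d) (Y : measurableType d') (A : Type)
    (f : Y -> A) (g : X -> Y) :
  measurable_fun setT g -> fin_measurable f -> fin_measurable (fun x => f (g x)).
Proof. by move=> mg mf a; rewrite -[X in measurable X]setTI; exact: (mg measurableT _ (mf a)). Qed.

Section Probabilities.
Context d (X : measurableType d) (R : realType).
Implicit Type P : probability X R.

Definition pr P S : R := fine (P S).

Lemma prE P S : measurable S -> P S = (pr P S)%:E.
Proof. by move=> mS; rewrite fineK// fin_num_measure. Qed.

Lemma pr_ge0 P S : 0 <= pr P S. Proof. by rewrite fine_ge0. Qed.

Lemma pr_le P S S' : measurable S -> measurable S' -> S `<=` S' -> pr P S <= pr P S'.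
Proof.
move=> mS mS' SS'; rewrite fine_le ?fin_num_measure//.
by apply: le_measure => //; rewrite inE.
Qed.

Lemma pr_setT P : pr P setT = 1. Proof. by rewrite /pr probability_setT. Qed.
Lemma pr_set0 P : pr P set0 = 0. Proof. by rewrite /pr measure0. Qed.

Lemma pr_le1 P S : measurable S -> pr P S <= 1.
Proof. by move=> mS; rewrite -(pr_setT P) pr_le. Qed.

Lemma pr_partition P (A : finType) (f : X -> A) S : measurable S -> fin_measurable f ->
  pr P S = \sum_a pr P (S `&` [set x | f x = a]).
Proof.
move=> mS mf; have mSf a : measurable (S `&` [set x | f x = a]) by exact: measurableI.
have mSs (s : seq A) : measurable (S `&` [set x | f x \in s]).
  by apply: measurableI => //; exact: (@fin_measurable_pred _ _ _ _ (fun a => a \in s)).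
have main (s : seq A) : uniq s ->
    pr P (S `&` [set x | f x \in s]) = \sum_(a <- s) pr P (S `&` [set x | f x = a]).
  elim: s => [_|a s IHs /=/andP[as_ us]].
    by rewrite big_nil (_ : S `&` _ = set0) ?pr_set0//; apply/seteqP; split=> x // [].
  rewrite big_cons -IHs//.
  rewrite (_ : S `&` [set x | f x \in a :: s] =
      (S `&` [set x | f x = a]) `|` (S `&` [set x | f x \in s])).
    rewrite /pr measureU ?fineD ?fin_num_measure//.
    by apply/seteqP; split=> x //= [[_ ->] [_]]; rewrite (negbTE as_).
  apply/seteqP; split=> x /=; rewrite inE.
    by move=> [Sx /orP[/eqP|]]; [left|right].
  by move=> [[Sx ->]|[Sx ->]]; rewrite ?eqxx ?orbT.
rewrite -big_enum -main ?enum_uniq//; congr pr; apply/seteqP; split=> x; last by case.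
by move=> Sx; split => //=; rewrite mem_enum.
Qed.

Lemma pr_bigcup_ord P k (F : 'I_k -> set X) : (forall i, measurable (F i)) ->
  pr P [set x | exists i, F i x] <= \sum_i pr P (F i).
Proof.
elim: k F => [|k IHk] F mF.
  by rewrite big_ord0 (_ : [set x | _] = set0) ?pr_set0//; apply/seteqP; split=> x // [[]].
rewrite big_ord_recl.
have mU : measurable [set x | exists i : 'I_k, F (lift ord0 i) x].
  rewrite (_ : [set x | _] = \bigcup_(i in [set: 'I_k]) F (lift ord0 i)).
    by apply: fin_bigcup_measurable => [|i _] //; exact: finite_finset.
  by apply/seteqP; split=> x [i]; [exists i|move=> _ ?; exists i].
rewrite (_ : [set x | _] = F ord0 `|` [set x | exists i : 'I_k, F (lift ord0 i) x]); last first.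
  apply/seteqP; split=> x.
    by move=> [i]; case: (unliftP ord0 i) => [j|] -> Fi; [right; exists j|left].
  by move=> [|[i]] ?; [exists ord0|exists (lift ord0 i)].
apply: (le_trans _ (lerD (lexx _) (IHk _ _))) => //.
rewrite -lee_fin EFinD -!prE//; first exact: measureU2.
exact: measurableU.
Qed.
End Probabilities.

Section Laws.
Context d d' (X : measurableType d) (Y : measurableType d') (R : realType).

Definition law (P : probability X R) (f : X -> Y) (mf : measurable_fun setT f) :
  probability Y R := distribution P (mfun_Sub (mem_set mf)).

Lemma pr_law P f (mf : measurable_fun setT f) S : pr (law P mf) S = pr P (f @^-1` S).
Proof. by []. Qed.
End Laws.

Section ProductLaw.
Variables (R : realType) (I : choiceType) (A : alphabetType) (w : I -> A -> R).

Lemma measurable_coords (s : seq I) (Q : I -> pred A) :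
  measurable [set eta : config I A | forall i, i \in s -> Q i (eta i)].
Proof.
elim: s => [|i s IHs]; first by rewrite (_ : [set _ | _] = setT)//; apply/seteqP; split.
rewrite (_ : [set _ | _] = [set eta : config I A | Q i (eta i)] `&`
    [set eta : config I A | forall i, i \in s -> Q i (eta i)]).
  apply: measurableI => //.
  exact: (@fin_measurable_pred _ _ _ _ (fun a => Q i a) (fin_measurable_coord i)).
apply/seteqP; split=> eta /=.
  by move=> h; split=> [|j js]; apply: h; rewrite inE ?eqxx// js orbT.
by move=> [hi hs] j; rewrite inE => /orP[/eqP ->|/hs].
Qed.

Lemma product_law_pred (m : probability (config I A) R) (s : seq I) (Q : I -> pred A) :
  has_product_law w m -> uniq s ->
  pr m [set eta : config I A | forall i, i \in s -> Q i (eta i)] =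
  \prod_(i <- s) \sum_(a | Q i a) w i a.
Proof.
(* Sites of [s1] carry a predicate, sites of [s2] a prescribed letter. Partitioning by the letter at
   the head of [s1] moves that site to [s2]; once [s1] is empty, the product law applies. *)
move=> mw; suff main (s1 s2 : seq I) (b : I -> A) : uniq (s1 ++ s2) ->
    pr m [set eta : config I A | forall i, i \in s1 ++ s2 ->
      if i \in s1 then Q i (eta i) else eta i == b i] =
    \prod_(i <- s1) (\sum_(a | Q i a) w i a) * \prod_(i <- s2) w i (b i).
  move=> us; have := @main s [::] (fun=> point); rewrite cats0 big_nil mulr1 => <-//.
  congr pr; apply/seteqP; split=> eta /= h i is_; have := h i is_; by rewrite is_.
elim: s1 s2 b => [|i s1 IHs1] s2 b us.
  rewrite big_nil mul1r /pr (_ : [set _ | _] =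
    [set eta : config I A | forall i, i \in s2 -> eta i = b i]) ?mw//.
  by apply/seteqP; split=> eta /= h i /h; [move/eqP|move->].
have us' : uniq (s1 ++ i :: s2) by rewrite -cat1s uniq_catCA.
have is1 : i \notin s1 by move: us; rewrite /= mem_cat negb_or => /andP[/andP[]].
have is2 : i \notin s2 by move: us; rewrite /= mem_cat negb_or => /andP[/andP[]].
rewrite (pr_partition _ _ (fin_measurable_coord i)); last first.
  exact: (@measurable_coords ((i :: s1) ++ s2)
    (fun j a => if j \in i :: s1 then Q j a else a == b j)).
rewrite big_cons [X in X * _ * _]big_mkcond -mulrA mulr_suml /=; apply: eq_bigr => a _.
case: ifPn => Qa; last first.
  rewrite mul0r (_ : _ `&` _ = set0) ?pr_set0//; apply/seteqP; split=> eta //= [h e].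
  have := h i; rewrite !inE eqxx /= => /(_ isT); rewrite e => Qia.
  by rewrite Qia in Qa.
pose b' j := if j == i then a else b j.
transitivity (\prod_(j <- s1) (\sum_(c | Q j c) w j c) * \prod_(j <- i :: s2) w j (b' j)).
  rewrite -IHs1//; congr pr; apply/seteqP; split=> eta /=.
    move=> [h e] j; have [->|ji] := eqVneq j i.
      by rewrite (negbTE is1) e /b' eqxx.
    move=> js; have := h j; rewrite !inE (negbTE ji) /= /b' (negbTE ji); apply.
    by move: js; rewrite !mem_cat inE (negbTE ji).
  move=> h; have e : eta i = a.
    have := h i; rewrite (negbTE is1) mem_cat inE eqxx orbT /b' eqxx => /(_ isT).
    by move/eqP.
  split => // j; rewrite !inE; have [->|ji] /= := eqVneq j i; first by rewrite e.
  move=> js; have := h j; rewrite /b' (negbTE ji); apply.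
  by move: js; rewrite !mem_cat inE (negbTE ji).
rewrite big_cons {1}/b' eqxx mulrCA; congr (_ * (_ * _)).
rewrite big_seq [RHS]big_seq; apply: eq_bigr => j js; rewrite /b'; case: eqP => // ji.
by rewrite ji (negbTE is2) in js.
Qed.
End ProductLaw.

Lemma pr_close d (X : measurableType d) (R : realType) (P : probability X R) (S1 S2 Bad : set X) :
  measurable S1 -> measurable S2 -> measurable Bad ->
  S1 `<=` S2 `|` Bad -> S2 `<=` S1 `|` Bad -> `|pr P S1 - pr P S2| <= pr P Bad.
Proof.
move=> m1 m2 mB.
have main S T : measurable S -> measurable T -> S `<=` T `|` Bad -> pr P S <= pr P T + pr P Bad.
  move=> mS mT ST; apply: (le_trans (pr_le P mS (measurableU _ _ mT mB) ST)).
  by rewrite -lee_fin EFinD -!prE//; [exact: measureU2|exact: measurableU].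
move=> /(main _ _ m1 m2) h1 /(main _ _ m2 m1) h2.
by rewrite ler_norml; apply/andP; split; lra.
Qed.

(** * Configurations seen through finite windows *)

Section Windows.
Variable A : alphabetType.
Local Notation configZ := (config int A).

Definition win k (x : int) (eta : int -> A) : {ffun 'I_k -> A} := [ffun i : 'I_k => eta (x + i%:Z)].

Lemma fin_measurable_win k x : fin_measurable (fun eta : configZ => win k x eta).
Proof. by apply: fin_measurable_ffun => i; exact: fin_measurable_coord. Qed.

(** Recovers a configuration on [-n, n] from its centred window, so that a local set or a cylinder
    function becomes a function on a finite type. *)
Definition unwin n (w : {ffun 'I_(n.*2.+1) -> A}) : int -> A :=
  fun z => if (absz z <= n)%N then w (inord (absz (z + n%:Z))) else point.

Lemma unwin_win n (eta : int -> A) z : (absz z <= n)%N ->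
  unwin (win n.*2.+1 (- n%:Z) eta) z = eta z.
Proof.
move=> zn; rewrite /unwin zn ffunE inordK; last by lia.
by congr eta; lia.
Qed.

Definition local_set (B : set configZ) := exists n : nat, forall eta eta' : configZ,
  (forall z, (absz z <= n)%N -> eta z = eta' z) -> B eta -> B eta'.

Lemma local_setE B : local_set B -> exists n, 
  B = [set eta | B (unwin (win n.*2.+1 (- n%:Z) eta))].
Proof.
move=> [n nB]; exists n; apply/seteqP; split=> eta /=; apply: nB => z zn;
  by rewrite unwin_win.
Qed.

Lemma measurable_local_set B : local_set B -> measurable B.
Proof.
move=> /local_setE[n ->].
have := @fin_measurable_pred _ _ _ _ 
  (fun w : {ffun 'I_n.*2.+1 -> A} => B (unwin w)) (@fin_measurable_win n.*2.+1 (- n%:Z)).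
by [].
Qed.

(** Local sets form a pi-system generating the sigma-algebra, and each is a finite disjoint union of
    window events. *)
Lemma probability_unique (R : realType) (mu nu : probability configZ R) :
  (forall k x w, pr mu [set eta | win k x eta = w] = pr nu [set eta | win k x eta = w]) ->
  forall B, measurable B -> mu B = nu B.
Proof.
move=> mu_nu B mB; apply: (@g_sigma_algebra_measure_unique _ _ _ local_set _ (fun=> setT)) => //.
- exact: measurable_local_set.
- by move=> _; exists 0%N.
- by apply/seteqP; split=> // x _; exists 0%N.
- move=> B1 B2 [n1 nB1] [n2 nB2]; exists (maxn n1 n2) => eta eta' h [h1 h2].
  by split; [apply: nB1 h1|apply: nB2 h2] => z zn; apply: h; rewrite leq_max zn ?orbT.
- move=> C LC; have mC := measurable_local_set LC.
  suff e : pr mu C = pr nu C.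
    by transitivity ((pr mu C)%:E); [exact: prE|rewrite e; exact/esym/prE].
  have [n eC] := local_setE LC.
  have mw := @fin_measurable_win n.*2.+1 (- n%:Z).
  rewrite (pr_partition mu mC mw) (pr_partition nu mC mw).
  apply: eq_bigr => w _; have [Cw|Cw] := pselect (C (unwin w)).
    rewrite (_ : _ `&` _ = [set eta | win n.*2.+1 (- n%:Z) eta = w])//.
    by apply/seteqP; split=> [eta []//|eta /= e]; split=> //; rewrite eC /= e.
  rewrite (_ : _ `&` _ = set0) ?pr_set0//.
  by apply/seteqP; split=> eta //= []; rewrite {1}eC /= => + e; rewrite e.
- by move=> k; rewrite (_ : _ setT = 1%E) ?ltry//; exact: probability_setT.
- apply: (sub_smallest2r _ _ mB).
  apply: smallest_sigma_algebra.
  move=> _ [z [a ->]]; exists (absz z) => eta eta' h /= <-.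
  by rewrite h.
Qed.
End Windows.

Section FiniteIntegral.
Context d (X : measurableType d) (R : realType) (P : probability X R).

Lemma integral_fin (A : finType) (f : X -> A) (h : A -> R) : fin_measurable f ->
  (\int[P]_x (h (f x))%:E = (\sum_a h a * pr P [set x | f x = a])%:E)%E.
Proof.
move=> mf.
transitivity (\int[P]_x (\sum_a (h a)%:E * (\1_[set x | f x = a] x)%:E))%E.
  apply: eq_integral => x _; rewrite (bigD1 (f x)) //= big1 => [|a ax].
    by rewrite indicE mem_set// mule1 adde0.
  by rewrite indicE memNset ?mule0// => /= e; rewrite e eqxx in ax.
have int1 a : P.-integrable setT (fun x => (\1_[set x | f x = a] x)%:E).
  by apply: integrable_indic; exact: mf.
rewrite integral_sum//; last by move=> a; exact: integrableZl.
rewrite -sumEFin; apply: eq_bigr => a _.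
rewrite integralZl// integral_indic// setIT EFinM; congr (_ * _)%E.
exact: (prE P (mf a)).
Qed.
End FiniteIntegral.

Section ProductProbability.
Context d1 d2 (X : measurableType d1) (Y : measurableType d2) (R : realType).
Variables (P : probability X R) (Q : probability Y R).

Let prod := (P \x Q)%E.
HB.instance Definition _ := Measure.on prod.
Let prod_setT : prod setT = 1%E.
Proof.
rewrite -setXTT [LHS]product_measure1E// -[RHS]mule1.
by congr (_ * _)%E; exact: probability_setT.
Qed.
HB.instance Definition _ := Measure_isProbability.Build _ _ _ prod prod_setT.
Definition product_probability : probability (X * Y)%type R := prod.

Lemma pr_prodX S T : measurable S -> measurable T ->
  pr product_probability (S `*` T) = pr P S * pr Q T.
Proof.
by move=> mS mT; rewrite {1}/pr [product_probability _]product_measure1E// fineM//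
  fin_num_measure.
Qed.

Lemma product_probabilityE S :
  (product_probability S = \int[P]_x Q (xsection S x))%E.
Proof. by []. Qed.
End ProductProbability.

(** * Existence of an i.i.d. labeling *)

Lemma big_label (V : nmodType) (F : label -> V) :
  \sum_l F l = F Trap + F Target + F Open.
Proof.
rewrite -big_enum; have : perm_eq (enum (label : finType)) [:: Trap; Target; Open].
  by apply: uniq_perm; rewrite ?enum_uniq// => -[]; rewrite mem_enum.
by move=> /(perm_big _) /= ->; rewrite !big_cons big_nil /=; rewrite addr0 addrA.
Qed.

Section IidLabels.
Variables (R : realType) (p q : R).
Hypotheses (hp : 0 <= p) (hq : 0 <= q) (hpq1 : p + q <= 1).
Local Notation mass := (label_mass p q).

Lemma mass_ge0 l : 0 <= mass l.
Proof. by case: l => //=; move: (hp) (hq) (hpq1) => *; lra. Qed.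

Lemma mass_sum : \sum_l mass l = 1.
Proof. by rewrite big_label /=; ring. Qed.

(** [0,1) is cut into one interval per label, of length its mass, and [shift] stretches each of them
    affinely onto [0,1). The digits of a uniform point are its itinerary under this map, as in a
    number expansion with unequal digits, and are therefore independent. *)
Definition start (l : label) : R :=
  match l with Trap => 0 | Target => p | Open => p + q end.
Definition digit (u : R) : label := if u < p then Trap else if u < p + q then Target else Open.
Definition shift (u : R) : R := (u - start (digit u)) / mass (digit u).

Lemma digitE u l : 0 <= u < 1 -> (digit u = l) <-> (start l <= u < start l + mass l).
Proof.
move: (hp) (hq) (hpq1) => hp' hq' hpq' /andP[u0 u1].
rewrite /digit; case: (ltP u p) => h1; [|case: (ltP u (p + q)) => h2]; case: l => /=;
  split=> //; first [by move=> /andP[? ?]; exfalso; lra | by move=> _; apply/andP; split; lra].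
Qed.

Definition prefix_set n (w : nat -> label) : set R :=
  [set u | 0 <= u < 1 /\ forall i, (i < n)%N -> digit (iter i shift u) = w i].

(* The sets with a prescribed prefix of digits are half-open intervals of length the
   product of the masses; [shift] is only used where the mass it divides by is
   positive. *)
Lemma prefix_setE n (w : nat -> label) : exists a b : R, [/\ 0 <= a, a <= b, b <= 1,
  b - a = \prod_(i < n) mass (w i) & prefix_set n w = [set` `[a, b[]].
Proof.
elim: n w => [|n IHn] w.
  exists 0, 1; split => //; rewrite ?big_ord0 ?subr0//.
  apply/seteqP; split=> u /=; rewrite in_itv /=; [by case|by split].
have [a [b [a0 ab b1 eab eP]]] := IHn (fun i => w i.+1).
set m := mass (w 0%N); set c := start (w 0%N).
have m0 : 0 <= m by exact: mass_ge0.
have c0 : 0 <= c by rewrite /c; case: (w 0%N) => //=; exact: addr_ge0.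
have cm : c + m <= 1 by move: (hp) (hq) (hpq1) => *; rewrite /c /m; case: (w 0%N) => /=; lra.
(* The part of [c, c + m) that the affine branch of [shift] maps onto [a, b). *)
exists (c + m * a), (c + m * b); split.
- by rewrite addr_ge0// mulr_ge0.
- by rewrite lerD2l ler_wpM2l.
- by rewrite (le_trans _ cm)// lerD2l ler_piMr.
- by rewrite big_ord_recl /= -/m -eab; ring.
have mam : m * a <= m by apply: ler_piMr => //; exact: le_trans ab b1.
have mbm : m * b <= m by exact: ler_piMr.
apply/seteqP; split=> u /=; rewrite in_itv /=.
  move=> [u01 h]; have /(digitE _ u01) := h 0%N isT; rewrite /= -/c -/m => /andP[cu ucm].
  have mp : 0 < m by move: cu ucm; lra.
  have : prefix_set n (fun i => w i.+1) (shift u).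
    split=> [|i il]; last by rewrite -iterSr; exact: h.
    rewrite /shift (h 0%N isT) -/c -/m divr_ge0 ?subr_ge0//=.
    by rewrite ltr_pdivrMr// mul1r ltrBlDl.
  rewrite eP /= in_itv /= /shift (h 0%N isT) -/c -/m ler_pdivlMr// ltr_pdivrMr//.
  by move=> /andP[]; rewrite ![_ * m]mulrC lerBrDl ltrBlDl => -> ->.
move=> /andP[hl hr].
have mp : 0 < m.
  rewrite lt_def m0 andbT; apply/eqP => mz; move: hl hr; rewrite mz !mul0r; lra.
have ma0 : 0 <= m * a by rewrite mulr_ge0.
have u01 : 0 <= u < 1 by apply/andP; split; lra.
have d0 : digit u = w 0%N by apply/(digitE _ u01); apply/andP; split; rewrite -/c -/m; lra.
have : [set` `[a, b[] (shift u).
  rewrite /= in_itv /= /shift d0 -/c -/m ler_pdivlMr// ltr_pdivrMr//.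
  by rewrite ![_ * m]mulrC lerBrDl ltrBlDl hl.
by rewrite -eP => -[_ h]; split=> // -[|i] // il; rewrite iterSr; exact: h.
Qed.

Definition digits (u : R) : config nat label := fun n =>
  if 0 <= u < 1 then digit (iter n shift u) else Open.

Lemma measurable_prefix n w : measurable (prefix_set n w : set (measurableTypeR R)).
Proof. by have [a [b [_ _ _ _ ->]]] := prefix_setE n w; exact: measurable_itv. Qed.

Let unit_measurable : measurable ([set` `[0%R, 1%R[] : set (measurableTypeR R)).
Proof. exact: measurable_itv. Qed.

Lemma fin_measurable_digits n : fin_measurable (fun u : measurableTypeR R => digits u n).
Proof.
move=> l.
have mpre : measurable (\bigcup_(w in [set w : {ffun 'I_n.+1 -> label} | w ord_max = l])
    (prefix_set n.+1 (fun i => w (inord i)) : set (measurableTypeR R))).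
  by apply: fin_bigcup_measurable => [|w _]; [exact: finite_finset|exact: measurable_prefix].
have mC : measurable (~` [set` `[0%R, 1%R[] `&` [set _ : measurableTypeR R | Open = l]).
  apply: measurableI; first exact: measurableC.
  exact: (@fin_measurable_cst _ (measurableTypeR R) _ Open l).
have := measurableU _ _ mpre mC; congr (measurable _); apply/seteqP; split=> u /=.
  rewrite /digits; move=> [[w <- [u01 h]]|[/negP]].
    by rewrite u01 h// -[in RHS](inord_val ord_max).
  by rewrite in_itv /= => /negbTE ->.
rewrite /digits; case: ifPn => u01 e.
  left; exists [ffun i : 'I_n.+1 => digit (iter i shift u)]; first by rewrite /= ffunE.
  by split=> // i il; rewrite ffunE inordK.
by right; split=> //; apply/negP; rewrite in_itv.
Qed.

Lemma measurable_digits : measurable_fun setT (digits : measurableTypeR R -> _).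
Proof. by apply: measurable_config => n; exact: fin_measurable_digits. Qed.

Let unif := mrestr (@lebesgue_measure R) unit_measurable.
HB.instance Definition _ := Measure.on unif.
Let unif_setT : unif setT = 1%E.
Proof.
by rewrite /unif /mrestr setTI lebesgue_measure_itv /= lte_fin ltr01 oppr0 adde0.
Qed.
HB.instance Definition _ := Measure_isProbability.Build _ _ _ unif unif_setT.
Definition uniform01 : probability (measurableTypeR R) R := unif.

Lemma uniform01_itv (a b : R) : 0 <= a -> a <= b -> b <= 1 ->
  uniform01 [set` `[a, b[] = (b - a)%:E.
Proof.
move=> a0 ab b1.
transitivity (lebesgue_measure ([set` `[a, b[] : set R)).
  congr (lebesgue_measure _); apply/seteqP; split=> u /=; first by case.
  rewrite !in_itv /= => /andP[au ub]; split; rewrite ?au//.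
  by rewrite (le_trans a0 au) (lt_le_trans ub b1).
rewrite lebesgue_measure_itv /= lte_fin; case: ltP => // ba.
by rewrite (_ : b = a) ?subrr//; apply/eqP; rewrite eq_le ba ab.
Qed.

Definition iid_nat : probability (config nat label) R := law uniform01 measurable_digits.

Lemma iid_nat_prefix n (w : {ffun 'I_n -> label}) :
  pr iid_nat [set eta | [ffun i : 'I_n => eta i] = w] = \prod_i mass (w i).
Proof.
pose w' i := if insub i is Some j then w j else Open.
have w'E (i : 'I_n) : w' i = w i by rewrite /w' valK.
have [a [b [a0 ab b1 eab eP]]] := prefix_setE n w'.
rewrite (eq_bigr (fun i : 'I_n => mass (w' i))) => [|i _]; last by rewrite w'E.
rewrite -eab pr_law /pr -[RHS]/(fine (b - a)%:E) -uniform01_itv// -eP; congr fine.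
congr (lebesgue_measure _); apply/seteqP; split=> u /=.
  move=> [/ffunP h u01]; split=> //; split; first by move: u01; rewrite in_itv.
  move=> i il; have := h (Ordinal il); rewrite !ffunE /digits /=.
  by move: u01; rewrite in_itv /= => -> ->; rewrite -w'E.
move=> [[u01 h] u01']; split=> //; apply/ffunP => i.
by rewrite !ffunE /digits u01 h// w'E.
Qed.

Lemma iid_nat_law : has_product_law (fun _ : nat => mass) iid_nat.
Proof.
move=> s a us; pose N := (\max_(i <- s) i).+1.
have sN i : i \in s -> (i < N)%N by move=> is_; rewrite ltnS; exact: leq_bigmax_seq.
have mS : measurable [set eta : config nat label | forall i, i \in s -> eta i = a i].
  rewrite (_ : [set _ | _] = [set eta : config nat label | forall i, i \in s -> eta i == a i]).
    exact: (measurable_coords s (fun i l => l == a i)).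
  by apply/seteqP; split=> eta /= h i /h; [move=> ->|move/eqP].
rewrite (prE _ mS); congr EFin.
have mf : fin_measurable (fun eta : config nat label => [ffun i : 'I_N => eta i]).
  by apply: fin_measurable_ffun => i; exact: fin_measurable_coord.
rewrite (pr_partition _ mS mf).
(* A prefix contributes the product of its masses if it agrees with [a] on [s], and 0 otherwise.
   Exchanging sum and product leaves a factor 1 for every site outside [s]. *)
transitivity (\sum_(w : {ffun 'I_N -> label}) \prod_i
    (if (val i \in s) ==> (w i == a i) then mass (w i) else 0)).
  apply: eq_bigr => w _.
  have [h|] := boolP [forall i : 'I_N, (val i \in s) ==> (w i == a i)].
    transitivity (\prod_i mass (w i)); last by apply: eq_bigr => i _; rewrite (forallP h i).
    rewrite -iid_nat_prefix; congr pr; apply/seteqP; split=> eta /=; first by case.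
    move=> e; split=> // i is_; have := forallP h (Ordinal (sN _ is_)).
    by rewrite /= is_ /= -e ffunE => /eqP.
  rewrite negb_forall => /existsP[i hi].
  rewrite (bigD1 i)//= (negbTE hi) mul0r (_ : _ `&` _ = set0) ?pr_set0//.
  apply/seteqP; split=> eta //= [h e]; move: hi; rewrite negb_imply => /andP[is_].
  by rewrite -e ffunE h// eqxx.
rewrite -(bigA_distr_bigA (fun (i : 'I_N) l =>
  if (val i \in s) ==> (l == a i) then mass l else 0)) /=.
transitivity (\prod_(i < N) (if val i \in s then mass (a i) else 1)).
  apply: eq_bigr => i _; case: ifPn => is_ /=; last exact: mass_sum.
  by rewrite -big_mkcond big_pred1_eq.
rewrite -big_mkcond /= -(big_mkord (fun i => i \in s) (fun i => mass (a i))).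
rewrite -big_filter; apply: perm_big; apply: uniq_perm => //.
  by rewrite filter_uniq// iota_uniq.
move=> i; rewrite mem_filter mem_index_iota /=.
by case is_ : (i \in s) => //=; exact: sN.
Qed.

Definition label_map (eta : config nat label) : labeling := fun v => eta (pickle v).

Lemma measurable_label_map : measurable_fun setT label_map.
Proof. by apply: measurable_config => v; exact: fin_measurable_coord. Qed.

Lemma iid_labels_exist : exists P : probability labeling R,
  has_product_law (fun _ : vertex => mass) P.
Proof.
exists (law iid_nat measurable_label_map) => s a us.
have us' : uniq (map pickle s) by rewrite map_inj_uniq//; exact: (pcan_inj pickleK).
pose a' n := if unpickle n is Some v then a v else Open.
have := iid_nat_law a' us'; rewrite big_map => e.
transitivity (\prod_(v <- s) mass (a' (pickle v)))%:E; last first.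
  by congr EFin; apply: eq_bigr => v _; rewrite /a' pickleK.
rewrite -e; congr (iid_nat _); apply/seteqP; split=> eta /=.
  by move=> h n /mapP[v vs ->]; rewrite /a' pickleK; exact: h.
move=> h v vs; have := h (pickle v) (map_f _ vs); rewrite /a' pickleK; exact.
Qed.
End IidLabels.

(** * Evolution driven by labels *)

Section Evolution.
Variables (R : realType) (p q : R) (B : alphabetType) (upd : label -> B -> B -> B -> B).

(** Time runs against the second coordinate: the value at [v] uses the labels of the rows from v.2
    to v.2 + t - 1, and [eta] is placed on row v.2 + t. Increasing [t] at fixed [v] keeps the labels
    and moves the start away. *)
Fixpoint evolve (eta : int -> B) (lab : vertex -> label) (t : nat) (v : vertex) : B :=
  if t is t'.+1 then
    upd (lab v) (evolve eta lab t' (v.1 - 1, v.2 + 1)) (evolve eta lab t' (v.1, v.2 + 1))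
      (evolve eta lab t' (v.1 + 1, v.2 + 1))
  else eta v.1.

Definition site_law (a b c d : B) : R := \sum_(l | upd l a b c == d) label_mass p q l.

Definition nbr k (j : nat) (i : 'I_k) : 'I_k.+2 := inord (i + j).

Definition transition k (u : {ffun 'I_k.+2 -> B}) (w : {ffun 'I_k -> B}) : R :=
  \prod_i site_law (u (nbr 0 i)) (u (nbr 1 i)) (u (nbr 2 i)) (w i).

Fixpoint marginal (init : forall k, int -> {ffun 'I_k -> B} -> R) t k (x : int)
    (w : {ffun 'I_k -> B}) : R :=
  if t is t'.+1 then \sum_u marginal init t' (x - 1) u * transition u w
  else init k x w.

Section Law.
Context d (X : measurableType d) (P : probability X R).
Variables (eta : X -> int -> B) (lab : X -> vertex -> label).
Variable init : forall k, int -> {ffun 'I_k -> B} -> R.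
Hypothesis mlab : forall v, fin_measurable (fun o => lab o v).
Hypothesis meta : forall z, fin_measurable (fun o => eta o z).
(** Covers both a deterministic start, on the space of labelings alone, and a random start
    independent of the labels, on a product space. *)
Hypothesis indep0 : forall k x (w : {ffun 'I_k -> B}) (s : seq vertex) (Q : vertex -> pred label),
  uniq s ->
  pr P ([set o | win k x (eta o) = w] `&` [set o | forall v, v \in s -> Q v (lab o v)]) =
  init x w * \prod_(v <- s) \sum_(l | Q v l) label_mass p q l.

Lemma fin_measurable_evolve t v : fin_measurable (fun o => evolve (eta o) (lab o) t v).
Proof.
elim: t v => [|t IHt] v /=; first exact: meta.
have m4 := fin_measurable_pair (mlab v) (fin_measurable_pair (IHt (v.1 - 1, v.2 + 1))
  (fin_measurable_pair (IHt (v.1, v.2 + 1)) (IHt (v.1 + 1, v.2 + 1)))).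
exact: (fin_measurable_comp (fun z => upd z.1 z.2.1 z.2.2.1 z.2.2.2) m4).
Qed.

Definition row t k (x y : int) (o : X) : {ffun 'I_k -> B} :=
  win k x (fun z => evolve (eta o) (lab o) t (z, y)).

Lemma fin_measurable_row t k x y : fin_measurable (row t k x y).
Proof. by apply: fin_measurable_ffun => i; exact: fin_measurable_evolve. Qed.

Lemma measurable_labels (s : seq vertex) (Q : vertex -> pred label) :
  measurable [set o | forall v, v \in s -> Q v (lab o v)].
Proof.
elim: s => [|v s IHs]; first by rewrite (_ : [set _ | _] = setT)//; apply/seteqP; split.
rewrite (_ : [set _ | _] = [set o | Q v (lab o v)] `&`
    [set o | forall v, v \in s -> Q v (lab o v)]).
  by apply: measurableI => //; exact: (@fin_measurable_pred _ _ _ _ (fun l => Q v l) (mlab v)).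
apply/seteqP; split=> o /=.
  by move=> h; split=> [|j js]; apply: h; rewrite inE ?eqxx// js orbT.
by move=> [hv hs] j; rewrite inE => /orP[/eqP ->|/hs].
Qed.

(* Induction on [t] needs the labels of the rows below [y], which the evolution of
   row [y] has not used. *)
Lemma row_labels_law t k x y (w : {ffun 'I_k -> B}) (s : seq vertex) (Q : vertex -> pred label) :
  uniq s -> (forall v, v \in s -> v.2 < y) ->
  pr P ([set o | row t k x y o = w] `&` [set o | forall v, v \in s -> Q v (lab o v)]) =
  marginal init t x w * \prod_(v <- s) \sum_(l | Q v l) label_mass p q l.
Proof.
elim: t k x y w s Q => [|t IHt] k x y w s Q us sy; first exact: indep0.
have mS : measurable ([set o | row t.+1 k x y o = w] `&`
    [set o | forall v, v \in s -> Q v (lab o v)]).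
  by apply: measurableI; [exact: fin_measurable_row|exact: measurable_labels].
rewrite (pr_partition P mS (@fin_measurable_row t k.+2 (x - 1) (y + 1))) /= mulr_suml.
apply: eq_bigr => u _.
pose r : seq vertex := [seq (x + i%:Z, y) | i : 'I_k].
(* Given that the row above is [u], the event that this row is [w] is a condition on each label of
   the sites [r]. Adding these conditions to those on [s] puts the event into the form of the
   induction hypothesis. *)
pose Q' (v : vertex) (l : label) := if v \in s then Q v l else
  if (insub (absz (v.1 - x)) : option 'I_k) is Some i then
    upd l (u (nbr 0 i)) (u (nbr 1 i)) (u (nbr 2 i)) == w i else true.
have rs v : v \in r -> v \notin s.
  move=> /mapP[i _ ->]; apply/negP => /sy /=; by rewrite ltxx.
have Q'r (i : 'I_k) l : Q' (x + i%:Z, y) l = (upd l (u (nbr 0 i)) (u (nbr 1 i)) (u (nbr 2 i)) == w i).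
  rewrite /Q' (negbTE (rs _ _)); last by apply: map_f; rewrite mem_enum.
  by rewrite /= addrAC subrr add0r absz_nat valK.
have ur : uniq (s ++ r).
  rewrite cat_uniq us /=; apply/andP; split.
    by rewrite -all_predC; apply/allP => v /rs.
  rewrite map_inj_uniq ?enum_uniq// => i j [] /addrI [ij]; exact: val_inj.
have ry v : v \in s ++ r -> v.2 < y + 1.
  rewrite mem_cat => /orP[/sy|/mapP[i _ ->] /=]; last by rewrite ltzD1.
  by move=> h; rewrite ltzD1 ltW.
have := IHt k.+2 (x - 1) (y + 1) u (s ++ r) Q' ur ry; rewrite big_cat /=.
rewrite (eq_big_seq (fun v => \sum_(l | Q v l) label_mass p q l)); last first.
  by move=> v vs; apply: eq_bigl => l; rewrite /Q' vs.
rewrite big_map big_enum /=.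
rewrite (eq_bigr (fun i => site_law (u (nbr 0 i)) (u (nbr 1 i)) (u (nbr 2 i)) (w i))); last first.
  by move=> i _; apply: eq_bigl => l; rewrite Q'r.
rewrite -/(transition u w) [X in _ = _ * X -> _]mulrC mulrA => <-; congr pr.
have rowE o : row t k.+2 (x - 1) (y + 1) o = u -> forall i : 'I_k,
    row t.+1 k x y o i = upd (lab o (x + i%:Z, y)) (u (nbr 0 i)) (u (nbr 1 i)) (u (nbr 2 i)).
  move=> <- i; rewrite !ffunE /= !inordK//; try by have := ltn_ord i; lia.
  by congr (upd _ (evolve _ _ _ (_, _)) (evolve _ _ _ (_, _)) (evolve _ _ _ (_, _))); lia.
apply/seteqP; split=> o /=.
  move=> [[ew hs] eu]; split=> // v; rewrite mem_cat => /orP[vs|/mapP[i _ ->]].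
    by rewrite /Q' vs; exact: hs.
  by rewrite Q'r -ew rowE.
move=> [eu h]; split=> //; split.
  apply/ffunP => i; rewrite rowE//; apply/eqP; rewrite -Q'r; apply: h.
  by rewrite mem_cat map_f ?orbT// mem_enum.
by move=> v vs; have := h v; rewrite mem_cat vs /Q' vs; exact.
Qed.

Lemma row_law t k x y (w : {ffun 'I_k -> B}) :
  pr P [set o | row t k x y o = w] = marginal init t x w.
Proof.
have := @row_labels_law t k x y w [::] (fun _ _ => true) isT.
rewrite big_nil mulr1 => <-//; congr pr.
by apply/seteqP; split=> o /=; [split|case].
Qed.
End Law.
End Evolution.

(** * PCAs realised by random labels: kernel and iterates *)

Section LabelDrivenPCA.
Variables (R : realType) (p q : R) (B : alphabetType) (upd : label -> B -> B -> B -> B).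
Variable rl : 3.-tuple B -> B -> R.
Hypothesis rlE : forall a b, rl a b =
  site_law p q upd (tnth a ord0) (tnth a (inord 1)) (tnth a (inord 2)) b.
Variable P : probability labeling R.
Hypothesis Plaw : has_product_law (fun _ : vertex => label_mass p q) P.

Let F : pca R := @Pca R B 3 [tuple -1; 0; 1] rl.
Local Notation configZ := (config int B).

Lemma rule_window (eta : configZ) k x (w : {ffun 'I_k -> B}) :
  \prod_(i < k) rule (window (F := F) eta (x + i%:Z)) (w i) =
  transition p q upd (win k.+2 (x - 1) eta) w.
Proof.
apply: eq_bigr => i _; rewrite /= rlE !tnth_mktuple !ffunE.
have e0 : tnth [tuple -1; 0; 1] ord0 = -1 :> int by [].
have e1 : tnth [tuple -1; 0; 1] (inord 1) = 0 :> int by rewrite (tnth_nth 0) inordK.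
have e2 : tnth [tuple -1; 0; 1] (inord 2) = 1 :> int by rewrite (tnth_nth 0) inordK.
rewrite /= e0 e1 e2 !inordK; try by have := ltn_ord i; lia.
by congr (site_law _ _ _ (eta _) (eta _) (eta _) _); lia.
Qed.

Lemma product_law_win (m : set configZ -> \bar R) (f : int -> B -> R) k x (w : {ffun 'I_k -> B}) :
  has_product_law f m ->
  m [set eta | win k x eta = w] = (\prod_(i < k) f (x + i%:Z) (w i))%:E.
Proof.
move=> mf; pose a (z : int) : B := if insub (absz (z - x)) is Some i then w i else point.
have aE (i : 'I_k) : a (x + i%:Z) = w i by rewrite /a addrAC subrr add0r absz_nat valK.
have us : uniq [seq x + i%:Z | i : 'I_k].
  by rewrite map_inj_uniq ?enum_uniq// => i j /addrI [ij]; exact: val_inj.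
rewrite (_ : [set eta | _] = [set eta : configZ | forall z,
    z \in [seq x + i%:Z | i : 'I_k] -> eta z = a z]).
  rewrite mf// big_map big_enum /=; congr EFin.
  by apply: eq_bigr => i _; rewrite aE.
apply/seteqP; split=> eta /=.
  by move=> e z /mapP[i _ ->]; rewrite aE -e ffunE.
move=> h; apply/ffunP => i; rewrite ffunE h ?aE//.
by apply/mapP; exists i; rewrite ?mem_enum.
Qed.

(** The kernel in [is_image] is arbitrary, but its product law already determines its window
    probabilities. *)
Lemma image_win (mu nu : probability configZ R) : is_image (F := F) mu nu ->
  forall k x (w : {ffun 'I_k -> B}), pr nu [set eta | win k x eta = w] =
    \sum_u pr mu [set eta | win k.+2 (x - 1) eta = u] * transition p q upd u w.
Proof.
move=> [K [Klaw nuE]] k x w.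
rewrite {1}/pr nuE; last exact: (fin_measurable_win x w).
rewrite (eq_integral
  (fun eta : configZ => (transition p q upd (win k.+2 (x - 1) eta) w)%:E)); last first.
  by move=> eta _; rewrite (product_law_win _ _ (Klaw eta)) rule_window.
rewrite (integral_fin mu (fun u => transition p q upd u w) (@fin_measurable_win B k.+2 (x - 1))) /=.
by apply: eq_bigr => u _; rewrite mulrC.
Qed.

Section Iterates.
Variable nu : probability configZ R.

Let init k x (w : {ffun 'I_k -> B}) := pr nu [set eta | win k x eta = w].
Let PP := product_probability nu P.

Let mlab (v : vertex) : fin_measurable (fun o : configZ * labeling => o.2 v).
Proof.
apply: (@fin_measurable_fun _ _ _ _ _ (fun lab : labeling => lab v)) => //.
exact: fin_measurable_coord.
Qed.
Let meta (z : int) : fin_measurable (fun o : configZ * labeling => o.1 z).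
Proof.
apply: (@fin_measurable_fun _ _ _ _ _ (fun eta : configZ => eta z)) => //.
exact: fin_measurable_coord.
Qed.
Let indep0 k x (w : {ffun 'I_k -> B}) (s : seq vertex) (Q : vertex -> pred label) : uniq s ->
  pr PP ([set o | win k x o.1 = w] `&` [set o | forall v, v \in s -> Q v (o.2 v)]) =
  init x w * \prod_(v <- s) \sum_(l | Q v l) label_mass p q l.
Proof.
move=> us; rewrite -(product_law_pred Q Plaw us) -pr_prodX//.
- exact: (fin_measurable_win x w).
- exact: (measurable_coords s Q).
Qed.

(** As [t] varies these are not successive states of one trajectory, since the start lies on row
    [t]. Only the law for each single [t] is that of the t-th state. *)
Definition evolve_config t (o : configZ * labeling) : configZ :=
  fun x => evolve upd o.1 o.2 t (x, 0).

Lemma measurable_evolve_config t : measurable_fun setT (evolve_config t).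
Proof. by apply: measurable_config => x; exact: fin_measurable_evolve. Qed.

(** Time 0 is set apart because [ergodic] asks for a sequence whose first term is equal to [nu]
    itself, not merely to a measure with the same values. *)
Definition iterate t : probability configZ R :=
  if t is 0 then nu else law PP (measurable_evolve_config t).

Lemma iterate_marginal t k x (w : {ffun 'I_k -> B}) :
  pr (iterate t) [set eta | win k x eta = w] = marginal p q upd init t x w.
Proof.
by case: t => [//|t]; rewrite pr_law -(row_law upd mlab meta indep0 t.+1 x 0 w).
Qed.

Lemma iterate_prod t k x (w : {ffun 'I_k -> B}) :
  pr (iterate t) [set eta | win k x eta = w] =
  pr PP [set o | win k x (fun z => evolve upd o.1 o.2 t (z, 0)) = w].
Proof. by rewrite iterate_marginal -(row_law upd mlab meta indep0 t x 0 w). Qed.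
End Iterates.

Definition one_step (eta : configZ) (lab : labeling) : configZ := evolve_config 1 (eta, lab).

Lemma measurable_one_step eta : measurable_fun setT (one_step eta).
Proof.
apply: measurable_config => x.
exact: (fin_measurable_comp (fun l => upd l (eta (x - 1)) (eta x) (eta (x + 1)))
  (fin_measurable_coord ((x, 0) : vertex))).
Qed.

Definition step_kernel (eta : configZ) : {measure set configZ -> \bar R} :=
  law P (measurable_one_step eta).

Lemma step_kernelE eta S :
  step_kernel eta S = P (xsection (evolve_config 1 @^-1` S) eta).
Proof. by congr (P _); apply/seteqP; split=> lab; rewrite /xsection /= inE. Qed.

Let measurable_step_kernel U : measurable U ->
  measurable_fun setT (step_kernel ^~ U).
Proof.
move=> mU; have mE : measurable (evolve_config 1 @^-1` U).
  by rewrite -[X in measurable X]setTI; exact: measurable_evolve_config.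
apply: eq_measurable_fun (measurable_fun_xsection P mE) => eta _.
by rewrite /= step_kernelE.
Qed.

HB.instance Definition _ := isKernel.Build _ _ _ _ R step_kernel measurable_step_kernel.

Let step_kernel_setT eta : step_kernel eta setT = 1%E.
Proof. exact: probability_setT. Qed.

HB.instance Definition _ := Kernel_isProbability.Build _ _ _ _ R step_kernel step_kernel_setT.

Lemma step_kernel_law eta :
  has_product_law (fun x => rule (window (F := F) eta x)) (step_kernel eta).
Proof.
move=> s a us; pose Q (v : vertex) l :=
  upd l (eta (v.1 - 1)) (eta v.1) (eta (v.1 + 1)) == a v.1.
have us' : uniq [seq ((z, 0) : vertex) | z <- s] by rewrite map_inj_uniq// => z z' [].
have := product_law_pred Q Plaw us'; rewrite big_map /=.
rewrite (eq_bigr (fun z => rule (window (F := F) eta z) (a z))) => [<-|z _]; last first.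
  have e0 : tnth [tuple -1; 0; 1] ord0 = -1 :> int by [].
  have e1 : tnth [tuple -1; 0; 1] (inord 1) = 0 :> int by rewrite (tnth_nth 0) inordK.
  have e2 : tnth [tuple -1; 0; 1] (inord 2) = 1 :> int by rewrite (tnth_nth 0) inordK.
  by rewrite /= rlE !tnth_mktuple /= e0 e1 e2 addr0.
rewrite -prE; last exact: measurable_coords.
congr (P _); apply/seteqP; split=> lab /=.
  by move=> h v /mapP[z zs ->]; apply/eqP; exact: h.
by move=> h z zs; apply/eqP; apply: (h (z, 0)); exact: map_f.
Qed.

(** Integrating the kernel that applies one row of random labels yields the law [iterate mu 1], and
    this is determined by its window probabilities. *)
Lemma win_image (mu nu : probability configZ R) :
  (forall k x (w : {ffun 'I_k -> B}), pr nu [set eta | win k x eta = w] =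
    \sum_u pr mu [set eta | win k.+2 (x - 1) eta = u] * transition p q upd u w) ->
  is_image (F := F) mu nu.
Proof.
move=> H; exists step_kernel; split; first exact: step_kernel_law.
move=> S mS.
rewrite (eq_integral (fun eta : configZ => P (xsection (evolve_config 1 @^-1` S) eta))); last first.
  by move=> eta _; rewrite step_kernelE.
rewrite -product_probabilityE -[RHS]/(iterate mu 1 S).
apply: probability_unique mS => k x w.
by rewrite iterate_marginal H.
Qed.
End LabelDrivenPCA.

(** * The weight inequality *)

Definition isZ : pred (option bool) := pred1 (Some false).
Definition isQ : pred (option bool) := pred1 None.
Definition isO : pred (option bool) := pred1 (Some true).
Definition isN : pred (option bool) := predC1 (Some true).
Definition isAny : pred (option bool) := predT.

(** All that the weight inequality uses about the law. Translation invariance is contained in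
    [br_rcons] and [br_rev]: a free letter can be added at either end. *)
Record word_prob (R : realFieldType) (br : seq (pred (option bool)) -> R) : Prop := WordProb {
  br_ge0 : forall l, 0 <= br l ;
  br_le : forall l1 l2, size l1 = size l2 ->
    (forall i a, nth isAny l1 i a -> nth isAny l2 i a) -> br l1 <= br l2 ;
  br_splitN : forall l1 l2, br (l1 ++ isN :: l2) = br (l1 ++ isZ :: l2) + br (l1 ++ isQ :: l2) ;
  br_splitT : forall l1 l2, br (l1 ++ isAny :: l2) = br (l1 ++ isO :: l2) + br (l1 ++ isN :: l2) ;
  br_rcons : forall l, br (rcons l isAny) = br l ;
  br_rev : forall l, br (rev l) = br l }.

(** * Signs of the polynomial coefficients *)

Section Coefficients.
Variables (R : realFieldType) (p q : R).
Local Notation r := (1 - p - q).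
Local Notation s := (1 - q).
Local Notation g := (r - p ^+ 2).
(* With M a mixed window (no 1, not 000) and N a letter other than 1,
   [weight br - weight br' - kappa * br [:: isQ]] involves the words M1, MN1, MNN1
   and MNNN with coefficients [cM1], [- cC], [- cB] and [cm]. *)
Definition kappa := (p + q) ^+ 3 / 32%:R.
Definition cA1 := r ^+ 2 * (1 + s - g * s ^+ 2).
Definition cB2 := 2 * (r ^+ 2 * p * (1 - g * s)) + r ^+ 2 * p.
Definition cB3 := 2 * r ^+ 2 * p ^+ 2 * (1 - g).
Definition cm := 1 - r * (1 + 2 * p + 2 * p ^+ 2) + r ^+ 2 * (p + 2 * p ^+ 2)
  + 2 * g * r * p ^+ 3 - kappa.
Definition cC := cB2 + cB3 - cm.
Definition cB := cB3 - cm.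
Definition cH := 2 * (p + q + p ^+ 2) - r ^+ 2 * p - 2 * r ^+ 2 * p ^+ 2.
Definition cM1 := 2 * (1 - cA1) - cB2 - cB3 + cm - 2 * kappa.

Lemma bernstein_ge0 i j k : 0 <= p -> 0 <= q -> p + q <= 1 ->
  0 <= p ^+ i * q ^+ j * r ^+ k.
Proof. by move=> ? ? ?; rewrite !mulr_ge0 ?exprn_ge0// -addrA -opprD subr_ge0. Qed.

Definition exponents n := [seq (ij, n - ij.1 - ij.2)%N
  | ij <- [seq (i, j) | i <- iota 0 n.+1, j <- iota 0 n.+1] & (ij.1 + ij.2 <= n)%N].

Lemma bernstein_all_ge0 n : 0 <= p -> 0 <= q -> p + q <= 1 ->
  all (fun e => 0 <= p ^+ e.1.1 * q ^+ e.1.2 * r ^+ e.2) (exponents n).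
Proof. by move=> hp hq hr; apply/allP => -[[i j] k] _ /=; exact: bernstein_ge0. Qed.

(* The polynomials below have nonnegative coefficients once they are homogenised
   in p, q and r by means of p + q + r = 1. *)
Ltac bern n := let hp := fresh in let hq := fresh in let hr := fresh in
  move=> hp hq hr; have := bernstein_all_ge0 n hp hq hr; rewrite /= ?expr0;
  repeat (case/andP; let h := fresh in move=> h); move=> _; lra.

(** The tightest condition on [kappa]: for q = 0, [cm] equals p^3 - 2 p^4 + 2 p^6 - kappa, so a
    [kappa] of order below three would make it negative for small p. *)
Lemma cm_ge0 : 0 <= p -> 0 <= q -> p + q <= 1 -> 0 <= cm.
(* Although the polynomial has degree 6, on the edge q = 0 its expansion in degree 6 has the
   coefficient -35/32 at p^5 r. Degree 9 is the first in which all coefficients on this edge are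
   nonnegative. *)
Proof. rewrite /cm /kappa. bern 9%N. Qed.

(** Four inequalities, because [cC] and [cB] have no fixed sign and enter only through their
    positive parts. *)
Lemma cM1_ge0 : 0 <= p -> 0 <= q -> p + q <= 1 ->
  [/\ 0 <= cM1, 0 <= cM1 - cB, 0 <= cM1 - cC & 0 <= cM1 - cC - cB].
Proof.
rewrite /cM1 /cC /cB /cm /cA1 /cB2 /cB3 /kappa => hp hq hr.
by split; move: hp hq hr; bern 6%N. Qed.

Lemma cH_ge0 : 0 <= p -> 0 <= q -> p + q <= 1 ->
  [/\ 0 <= cH, 0 <= cH - cB, 0 <= cH - cC & 0 <= cH - cC - cB].
Proof.
rewrite /cH /cC /cB /cm /cB2 /cB3 /kappa => hp hq hr.
by split; move: hp hq hr; bern 6%N. Qed.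

(** This fixes the term p^2 in g: for q = 0 the third expression is 10 p^3 - 6 p^4, whereas g = r
    would add -2 p^2 and make it negative for small p. *)
Lemma cH'_ge0 : 0 <= p -> 0 <= q -> p + q <= 1 ->
  [/\ 0 <= cH - r ^+ 2 * p - 2 * r ^+ 2 * p ^+ 2,
      0 <= cH - r ^+ 2 * p - 2 * r ^+ 2 * p ^+ 2 - cB
    & 0 <= cH - r ^+ 2 * p - 4 * r ^+ 2 * p ^+ 2].
Proof.
rewrite /cH /cB /cm /cB3 /kappa => hp hq hr.
by split; move: hp hq hr; bern 6%N. Qed.

Lemma kappa_le1 : 0 <= p -> 0 <= q -> p + q <= 1 -> 0 <= kappa <= 1.
Proof.
rewrite /kappa => hp hq hr; have h : 0 <= p + q by lra.
by have := exprn_ge0 3 h; have := exprn_ile1 3 h hr; lra. Qed.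

End Coefficients.

(** In the application [m], [n1], [n2], [n3] are the [mixed] probabilities, and [h], [h4], [h5]
    those of ? followed by three, four and five zeros. Damping the word 000? by g leaves a surplus 2
    (1 - g) h, which pays for the terms in [x], [y], [e] and [z]. *)
Lemma weight_arith (R : realFieldType) (p q : R)
    (m n1 n2 n3 d m1 mn1 mnn1 b1 b2 b3 b5 b6 x y h h4 h5 e z : R) :
  let r := 1 - p - q in let s := 1 - q in let g := r - p ^+ 2 in
  0 <= p -> 0 <= q -> p + q <= 1 ->
  0 <= d -> 0 <= m1 -> 0 <= mn1 -> 0 <= mnn1 -> 0 <= n3 -> 0 <= x -> 0 <= y -> 0 <= h5 ->
  b1 + 2 * b2 + 2 * b3 - 2 * h - b5 - 2 * b6 = m + 2 * m1 + d ->
  n1 = m - m1 -> n2 = n1 - mn1 -> n3 = n2 - mnn1 -> b1 <= m + 2 * m1 + d ->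
  mn1 <= m1 + x -> mnn1 <= m1 + x + y -> x + h4 <= h -> y + h5 <= h4 ->
  e <= h + h4 -> z <= h + h4 + h5 ->
  r * m + 2 * (r * s * m - r ^+ 2 * n1)
  + 2 * (r * s ^+ 2 * m - r ^+ 2 * s * (n1 + n2) + r ^+ 3 * n2)
  - 2 * g * (r * s ^+ 3 * m - r ^+ 2 * s ^+ 2 * (n1 + n2 + n3)
    + r ^+ 3 * s * (2 * n3 + n2) - r ^+ 4 * n3)
  - r ^+ 2 * p * (n2 - e) - 2 * (r ^+ 2 * p ^+ 2 * (n3 - z))
  <= b1 + 2 * b2 + 2 * b3 - 2 * g * h - b5 - 2 * b6 - kappa p q * b1.
Proof.
move=> r s g hp hq hr d0 m10 mn10 mnn10 n30 x0 y0 h50 f1 f2 f3 f4 f5 f6 f7 f8 f9 f10 f11.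
have r0 : 0 <= r by rewrite /r; lra.
have h40 : 0 <= h4 by lra.
have u7 : 0 <= h - x - h4 by lra.
have u8 : 0 <= h4 - h5 by lra.
have u11 : 0 <= m + 2 * m1 + d - b1 by lra.
have u13 : 0 <= h4 - h5 - y by lra.
have em : m = n3 + mnn1 + mn1 + m1 by lra.
have en1 : n1 = n3 + mnn1 + mn1 by lra.
have en2 : n2 = n3 + mnn1 by lra.
have eb : b1 + 2 * b2 + 2 * b3 - 2 * g * h - b5 - 2 * b6 = m + 2 * m1 + d + 2 * (1 - g) * h by lra.
have [i1 i2 i3 i4] := cM1_ge0 hp hq hr.
have [j1 j2 j3 j4] := cH_ge0 hp hq hr.
have [k1 k2 k3] := cH'_ge0 hp hq hr.
have km := cm_ge0 hp hq hr.
have /andP[kap0 kap1] := kappa_le1 hp hq hr.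
set k := kappa p q in kap0 kap1 *.
(* Only a positive [cC] or [cB] makes the terms in [mn1] and [mnn1] harmful. The positive parts [C]
   and [B] charge them to [m1], [x] and [y]. *)
pose C := if 0 <= cC p q then cC p q else 0.
pose B := if 0 <= cB p q then cB p q else 0.
have C0 : 0 <= C by rewrite /C; case: ifP.
have B0 : 0 <= B by rewrite /B; case: ifP.
have CC : cC p q <= C by rewrite /C; case: ifP => // /negbT; rewrite -ltNge => /ltW.
have BB : cB p q <= B by rewrite /B; case: ifP => // /negbT; rewrite -ltNge => /ltW.
have ci : 0 <= cM1 p q - C - B by rewrite /C /B; do 2 case: ifP => _; rewrite ?subr0.
have cx : 0 <= cH p q - C - B by rewrite /C /B; do 2 case: ifP => _; rewrite ?subr0.
have ch : 0 <= cH p q - r ^+ 2 * p - 2 * r ^+ 2 * p ^+ 2 - B.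
  by rewrite /B; case: ifP => _; rewrite ?subr0.
have t1 : cC p q * mn1 <= C * (m1 + x) by apply: (le_trans (ler_wpM2r mn10 CC)); exact: ler_wpM2l.
have t2 : cB p q * mnn1 <= B * (m1 + x + y).
  by apply: (le_trans (ler_wpM2r mnn10 BB)); exact: ler_wpM2l.
have rp0 : 0 <= r ^+ 2 * p by rewrite mulr_ge0 ?exprn_ge0.
have rp1 : 0 <= r ^+ 2 * p ^+ 2 by rewrite mulr_ge0 ?exprn_ge0.
have t3 : r ^+ 2 * p * e <= r ^+ 2 * p * (h + h4) by exact: ler_wpM2l.
have t4 : r ^+ 2 * p ^+ 2 * z <= r ^+ 2 * p ^+ 2 * (h + h4 + h5) by exact: ler_wpM2l.
have t5 := mulr_ge0 ci m10.
have t6 := mulr_ge0 cx x0.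
have t7 : 0 <= cH p q * (h - x - h4) by exact: mulr_ge0.
have t8 : 0 <= (cH p q - r ^+ 2 * p - 2 * r ^+ 2 * p ^+ 2 - B) * (h4 - h5) by exact: mulr_ge0.
have t9 : 0 <= (cH p q - r ^+ 2 * p - 4 * r ^+ 2 * p ^+ 2) * h5 by exact: mulr_ge0.
have t10 : 0 <= cm p q * n3 by exact: mulr_ge0.
have t11 : 0 <= k * (m + 2 * m1 + d - b1) by exact: mulr_ge0.
have t12 : 0 <= (1 - k) * d by rewrite mulr_ge0 ?subr_ge0.
have t13 : 0 <= B * (h4 - h5 - y) by exact: mulr_ge0.

(* The claim now follows linearly from [t1] to [t13], every monomial in parameters and probabilities
   counting as one atom. *)
rewrite eb; move: t1 t2 t3 t4 t5 t6 t7 t8 t9 t10 t11 t12 t13.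
rewrite em en1 en2 {em en1 en2 eb u11 f1 f2 f3 f4 f5}.
rewrite /cM1 /cC /cB /cm /cH /cA1 /cB2 /cB3 -/k.
clear -C.
clearbody C B k; rewrite /g /r /s.
move=> *. lra.
Qed.

Section WeightInequality.
Variables (R : realFieldType) (p q : R) (br br' : seq (pred (option bool)) -> R).
Local Notation r := (1 - p - q).
Local Notation s := (1 - q).
Local Notation g := (r - p ^+ 2).
Local Notation Z := isZ.
Local Notation Q := isQ.
Local Notation O := isO.
Local Notation N := isN.
Local Notation T := isAny.

(* Found by linear programming: only words of length at most 4 are needed. *)
Definition weight (f : seq (pred (option bool)) -> R) : R :=
  f [:: Q] + 2 * f [:: Z; Q] + 2 * f [:: Z; Z; Q] - 2 * g * f [:: Z; Z; Z; Q]
  - f [:: Q; Z; Q] - 2 * f [:: Q; Z; Z; Q].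

(** A window is mixed if it contains no 1 and is not 000: exactly then an open site produces ?. The
    index counts further letters other than 1 in front of the window. *)
Definition mixed0 := br [:: N; N; N] - br [:: Z; Z; Z].
Definition mixed1 := br [:: N; N; N; N] - br [:: N; Z; Z; Z].
Definition mixed2 := br [:: N; N; N; N; N] - br [:: N; N; Z; Z; Z].
Definition mixed3 := br [:: N; N; N; N; N; N] - br [:: N; N; N; Z; Z; Z].
(** Inclusion and exclusion for two mixed windows, at distance two here and adjacent in
    [mixed_pair], with no 1 anywhere. *)
Definition mixed_overlap :=
  br [:: N; N; N; N; N] - br [:: Z; Z; Z; N; N] - br [:: N; N; Z; Z; Z] + br [:: Z; Z; Z; Z; Z].
Definition mixed_pair :=
  br [:: N; N; N; N; N; N] - br [:: Z; Z; Z; N; N; N] - br [:: N; N; N; Z; Z; Z]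
  + br [:: Z; Z; Z; Z; Z; Z].

(** In the last two words every inner site sees a window without 1, so it becomes 0 only by a trap;
    hence the factors p. *)
Definition word_step : Prop :=
  [/\ br' [:: Q] = r * mixed0,
      br' [:: Z; Q] = r * s * mixed0 - r ^+ 2 * mixed1,
      br' [:: Z; Z; Q] = r * s ^+ 2 * mixed0 - r ^+ 2 * s * (mixed1 + mixed2) + r ^+ 3 * mixed2,
      br' [:: Z; Z; Z; Q] = r * s ^+ 3 * mixed0 - r ^+ 2 * s ^+ 2 * (mixed1 + mixed2 + mixed3)
        + r ^+ 3 * s * (2 * mixed3 + mixed2) - r ^+ 4 * mixed3
    & br' [:: Q; Z; Q] = r ^+ 2 * p * mixed_overlap /\
      br' [:: Q; Z; Z; Q] = r ^+ 2 * p ^+ 2 * mixed_pair].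

Hypothesis brP : word_prob br.

Local Notation M1 := (br [:: N; N; N; O] - br [:: Z; Z; Z; O]).
Local Notation MN1 := (br [:: N; N; N; N; O] - br [:: Z; Z; Z; N; O]).
Local Notation MNN1 := (br [:: N; N; N; N; N; O] - br [:: Z; Z; Z; N; N; O]).
Local Notation D := (br [:: O; Q; O] + 2 * br [:: O; N; Q; O] + 2 * br [:: O; Q; Z; O]).
Local Notation x := (br [:: Q; Z; Z; Z; O]).
Local Notation h := (br [:: Q; Z; Z; Z]).
Local Notation h4 := (br [:: Q; Z; Z; Z; Z]).
Local Notation h5 := (br [:: Q; Z; Z; Z; Z; Z]).
Local Notation y := (br [:: Q; Z; Z; Z; Z; O]).
Local Notation e := (br [:: Z; Z; Z; N; N] - br [:: Z; Z; Z; Z; Z]).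
Local Notation z := (br [:: Z; Z; Z; N; N; N] - br [:: Z; Z; Z; Z; Z; Z]).

Let splitN l1 l2 := br_splitN brP l1 l2.
Let splitT l1 l2 := br_splitT brP l1 l2.
Let splitR l : br l = br (l ++ [:: O]) + br (l ++ [:: N]).
Proof. by rewrite -(br_rcons brP) -cats1 splitT. Qed.
Let splitL l : br l = br (O :: l) + br (N :: l).
Proof.
rewrite -(br_rev brP) splitR -(br_rev brP) -[X in _ + X](br_rev brP).
by rewrite !rev_cat !revK.
Qed.
Let le l1 l2 := br_le brP (l1 := l1) (l2 := l2).
Local Ltac le_tac := apply: le => // -[|[|[|[|[|[|i]]]]]] [[]|]//=.

Let mixed0E : mixed0 = br [:: N; N; Q] + br [:: N; Q; Z] + br [:: Q; Z; Z].
Proof.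
by rewrite /mixed0 (splitN [:: N; N] [::]) (splitN [:: N] [:: Z]) (splitN [::] [:: Z; Z]) /=; ring.
Qed.
Let M1E : M1 = br [:: N; N; Q; O] + br [:: N; Q; Z; O] + br [:: Q; Z; Z; O].
Proof.
by rewrite (splitN [:: N; N] [:: O]) (splitN [:: N] [:: Z; O]) (splitN [::] [:: Z; Z; O]) /=; ring.
Qed.
Let revs := (br_rev brP [:: Z; Q], br_rev brP [:: Z; Z; Q], br_rev brP [:: Z; Z; Z; Q],
  br_rev brP [:: N; N; Q], br_rev brP [:: Z; Q; N]).

(** The left side is the weight with g = 1. At p = q = 0 the weight after a step is [mixed0] + 2
    [M1], so [D] is exactly what the noiseless rule loses: the runs of at most two letters between
    two 1s that contain ? and hence die out. *)
Let blocks_gain : br [:: Q] + 2 * br [:: Z; Q] + 2 * br [:: Z; Z; Q] - 2 * br [:: Z; Z; Z; Q]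
  - br [:: Q; Z; Q] - 2 * br [:: Q; Z; Z; Q] = mixed0 + 2 * M1 + D.
Proof.
rewrite mixed0E M1E.
move: revs; rewrite /rev /= => -[[[[r1 r2] r3] r4] r5].
have := splitR [:: Q]; have := splitR [:: Q; N]; have := splitR [:: Z; Q].
have := splitR [:: Q; Z]; have := splitR [:: Q; Z; Z].
have := splitN [:: Q; Z] [::]; have := splitN [:: Q; Z; Z] [::].
have := splitL [:: Q; O]; have := splitL [:: N; Q; O]; have := splitL [:: Q; Z; O].
have := splitN [::] [:: Q; O]; have := splitN [:: Q] [:: O].
by rewrite /=; lra.
Qed.

Let mixed1E : mixed1 = mixed0 - M1.
Proof.
move: (br_rev brP [:: N; Z; Z; Z]) (splitR [:: N; N; N]) (splitR [:: Z; Z; Z]).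
by rewrite /mixed1 /mixed0 /rev /=; lra.
Qed.
Let mixed2E : mixed2 = mixed1 - MN1.
Proof.
move: (br_rev brP [:: N; N; Z; Z; Z]) (splitR [:: N; N; N; N]) (splitR [:: Z; Z; Z; N]).
by move: (br_rev brP [:: N; Z; Z; Z]); rewrite /mixed1 /mixed2 /rev /=; lra.
Qed.
Let mixed3E : mixed3 = mixed2 - MNN1.
Proof.
move: (br_rev brP [:: N; N; N; Z; Z; Z]) (splitR [:: N; N; N; N; N]) (splitR [:: Z; Z; Z; N; N]).
by move: (br_rev brP [:: N; N; Z; Z; Z]); rewrite /mixed3 /mixed2 /rev /=; lra.
Qed.

(** A ? followed by two letters other than 1 starts a mixed window. Otherwise a 1 follows within two
    places, and either a mixed window ends just before it or the run is one of the short ones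
    counted in [D]. *)
Let undec_le : br [:: Q] <= mixed0 + 2 * M1 + D.
Proof.
have hm : br [:: Q; N; N] <= mixed0.
  move: (br_rev brP [:: N; N; Q]); rewrite mixed0E /rev /= => ->.
  by rewrite -addrA lerDl addr_ge0 ?(br_ge0 brP).
have h1 : br [:: N; N; Q; O] <= M1 by rewrite M1E -addrA lerDl addr_ge0 ?(br_ge0 brP).
have h2 : br [:: N; Q; N; O] <= M1.
  rewrite (splitN [:: N] [:: N; O]) /= (_ : br [:: Z; Z; Z; O] = br ([:: Z] ++ Z :: [:: Z; O]))//.
  have : br [:: Z; Z; Z; O] <= br [:: N; Z; N; O] by le_tac.
  by rewrite /=; lra.
have h3 : br [:: O; Q; Q; O] <= br [:: O; N; Q; O] by le_tac.
have h4 := br_ge0 brP [:: O; Q; Z; O].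
have h0 := br_ge0 brP [:: O; N; Q; O].
have := splitR [:: Q]; have := splitR [:: Q; N]; have := splitL [:: Q; O].
have := splitL [:: N; Q; O]; have := splitN [:: Q] [:: O]; have := splitL [:: Q; Z; O].
have := splitL [:: Q; Q; O]; have := splitN [:: N; Q] [:: O].
by rewrite /=; lra.
Qed.

(** Shift the mixed window by one place to meet the 1: it stays mixed unless it becomes 000, and
    then the letter left behind is ?. *)
Let MN1_le : MN1 <= M1 + x.
Proof.
have : br [:: O; Z; Z; Z; O] <= br [:: O; N; N; N; O] by le_tac.
have : br [:: Z; Z; Z; Z; O] <= br [:: Z; Z; Z; N; O] by le_tac.
have := splitL [:: N; N; N; O]; have := splitL [:: Z; Z; Z; O].
by have := splitN [::] [:: Z; Z; Z; O]; rewrite /=; lra.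
Qed.

(** The same with a shift by two: if the last three letters are 000, the nearest ? is one or two
    places before them. *)
Let MNN1_le : MNN1 <= M1 + x + y.
Proof.
have prefix l : br [:: N, N & l] <= br l.
  have := splitL l; have := splitL (N :: l).
  by have := br_ge0 brP (O :: l); have := br_ge0 brP [:: O, N & l]; lra.
have := splitN [:: N; N; N; N] [:: O]; have := splitN [:: N; N; N] [:: Z; O].
have := splitN [:: N; N] [:: Z; Z; O].
have := prefix [:: N; N; Q; O]; have := prefix [:: N; Q; Z; O]; have := prefix [:: Q; Z; Z; O].
have : br [:: N; Q; Z; Z; Z; O] <= x.
  by have := splitL [:: Q; Z; Z; Z; O]; have := br_ge0 brP [:: O; Q; Z; Z; Z; O]; lra.
have := splitN [:: N] [:: Z; Z; Z; O]; have := splitN [::] [:: Z; Z; Z; Z; O].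
have : br [:: Z; Z; Z; Z; Z; O] <= br [:: Z; Z; Z; N; N; O] by le_tac.
by rewrite M1E /=; lra.
Qed.

Let h_ge : x + h4 <= h.
Proof.
have := splitR [:: Q; Z; Z; Z]; have := splitN [:: Q; Z; Z; Z] [::].
by have := br_ge0 brP [:: Q; Z; Z; Z; Q]; rewrite /=; lra.
Qed.
Let h4_ge : y + h5 <= h4.
Proof.
have := splitR [:: Q; Z; Z; Z; Z]; have := splitN [:: Q; Z; Z; Z; Z] [::].
by have := br_ge0 brP [:: Q; Z; Z; Z; Z; Q]; rewrite /=; lra.
Qed.
Let drop_right l : br (l ++ [:: N]) <= br l.
Proof. by have := splitR l; have := br_ge0 brP (l ++ [:: O]); lra. Qed.

(** After 000 the first letter other than 0 is a ? in the fourth or fifth place; reflected, these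
    two cases are bounded by [h] and [h4]. *)
Let e_le : e <= h + h4.
Proof.
have := splitN [:: Z; Z; Z] [:: N]; have := splitN [:: Z; Z; Z; Z] [::].
have := drop_right [:: Z; Z; Z; Q].
move: (br_rev brP [:: Z; Z; Z; Q]) (br_rev brP [:: Z; Z; Z; Z; Q]).
by rewrite /rev /=; lra.
Qed.
Let z_le : z <= h + h4 + h5.
Proof.
have := splitN [:: Z; Z; Z] [:: N; N]; have := splitN [:: Z; Z; Z; Z] [:: N].
have := splitN [:: Z; Z; Z; Z; Z] [::].
have := drop_right [:: Z; Z; Z; Q]; have := drop_right [:: Z; Z; Z; Q; N].
have := drop_right [:: Z; Z; Z; Z; Q].
move: (br_rev brP [:: Z; Z; Z; Q]) (br_rev brP [:: Z; Z; Z; Z; Q]).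
move: (br_rev brP [:: Z; Z; Z; Z; Z; Q]).
by rewrite /rev /=; lra.
Qed.

Let slacks_ge0 : [/\ 0 <= D, 0 <= M1, 0 <= MN1 & 0 <= MNN1] /\ 0 <= mixed3.
Proof.
have : br [:: Z; Z; Z; O] <= br [:: N; N; N; O] by le_tac.
have : br [:: Z; Z; Z; N; O] <= br [:: N; N; N; N; O] by le_tac.
have : br [:: Z; Z; Z; N; N; O] <= br [:: N; N; N; N; N; O] by le_tac.
have : br [:: N; N; N; Z; Z; Z] <= br [:: N; N; N; N; N; N] by le_tac.
have := br_ge0 brP [:: O; Q; O]; have := br_ge0 brP [:: O; N; Q; O].
by have := br_ge0 brP [:: O; Q; Z; O]; rewrite /mixed3; do !split; lra.
Qed.

Lemma weight_decr : 0 <= p -> 0 <= q -> p + q <= 1 -> word_step ->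
  weight br' <= weight br - kappa p q * br [:: Q].
Proof.
move=> hp hq hr [s1 s2 s3 s4 [s5 s6]].
have r0 : 0 <= r by lra.
rewrite /weight s1 s2 s3 s4 s5 s6 {s1 s2 s3 s4 s5 s6}.
have -> : mixed_overlap = mixed2 - e by rewrite /mixed_overlap /mixed2; ring.
have -> : mixed_pair = mixed3 - z by rewrite /mixed_pair /mixed3; ring.
have [[D0 M10 MN10 MNN10] n30] := slacks_ge0.
have x0 := br_ge0 brP [:: Q; Z; Z; Z; O]; have y0 := br_ge0 brP [:: Q; Z; Z; Z; Z; O].
have h50 := br_ge0 brP [:: Q; Z; Z; Z; Z; Z].
have rz : br [:: Z; Z; Z; Q] = h by rewrite -(br_rev brP).
rewrite rz; move: blocks_gain; rewrite rz => f1.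
exact: (@weight_arith R p q _ _ _ _ _ _ _ _ _ _ _ _ _ _ _ _ _ _ _ _ hp hq hr D0 M10 MN10
  MNN10 n30 x0 y0 h50 f1 mixed1E mixed2E mixed3E undec_le MN1_le MNN1_le h_ge h4_ge e_le 
  z_le).
Qed.

End WeightInequality.

(** * Decay of the undecided letter *)

Definition nor3 (a b c : option bool) : option bool :=
  if [|| a == Some true, b == Some true | c == Some true] then Some false
  else if [&& a == Some false, b == Some false & c == Some false] then Some true
  else None.

Definition upd3 (l : label) (a b c : option bool) : option bool :=
  match l with Trap => Some false | Target => Some true | Open => nor3 a b c end.

Section Words.
Variables (R : realType) (p q : R).
Local Notation B := (option bool).
Local Notation r := (1 - p - q).
Local Notation s := (1 - q).

Lemma site_law3_rev a b c d : site_law p q upd3 a b c d = site_law p q upd3 c b a d.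
Proof.
apply: eq_bigl => -[] //=; congr (_ == _).
by case: a b c => [[]|] [[]|] [[]|].
Qed.

(** In this form a product over adjacent sites expands into products of letter indicators, that is,
    into words, since N and Z at one place combine to Z. *)
Lemma site_law3_zero a b c :
  site_law p q upd3 a b c (Some false) = s - r * ((isN a)%:R * (isN b)%:R * (isN c)%:R).
Proof.
rewrite /site_law big_mkcond big_label /=.
by case: a b c => [[]|] [[]|] [[]|]; rewrite /nor3 /=; ring.
Qed.

Lemma site_law3_undec a b c :
  site_law p q upd3 a b c None = r * ((isN a)%:R * (isN b)%:R * (isN c)%:R
     - (isZ a)%:R * (isZ b)%:R * (isZ c)%:R).
Proof.
rewrite /site_law big_mkcond big_label /=.
by case: a b c => [[]|] [[]|] [[]|]; rewrite /nor3 /=; ring.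
Qed.

Definition revf k (w : {ffun 'I_k -> B}) : {ffun 'I_k -> B} := [ffun i => w (rev_ord i)].

Lemma revfK k : involutive (@revf k).
Proof. by move=> w; apply/ffunP => i; rewrite !ffunE rev_ordK. Qed.

Lemma transition_rev k (u : {ffun 'I_k.+2 -> B}) (w : {ffun 'I_k -> B}) :
  transition p q upd3 (revf u) (revf w) = transition p q upd3 u w.
Proof.
rewrite /transition (reindex_inj rev_ord_inj); apply: eq_bigr => i _.
rewrite !ffunE rev_ordK site_law3_rev.
have e j j' : (j + j' = 2)%N -> rev_ord (nbr j (rev_ord i)) = nbr j' i.
  move=> jj; apply: val_inj; have ik := ltn_ord i.
  by rewrite /= !inordK /=; lia.
by rewrite (e 2%N 0%N)// (e 1%N 1%N)// (e 0%N 2%N).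
Qed.

Definition undec k (x : int) (w : {ffun 'I_k -> B}) : R := (w == [ffun=> None])%:R.
Local Notation marg := (marginal p q upd3 undec).

Lemma marg_shift t k x y (w : {ffun 'I_k -> B}) : marg t x w = marg t y w.
Proof.
elim: t k x y w => [//|t IHt] k x y w /=.
by apply: eq_bigr => u _; congr (_ * _); exact: IHt.
Qed.

Lemma marg_rev t k x (w : {ffun 'I_k -> B}) : marg t x (revf w) = marg t x w.
Proof.
elim: t k x w => [|t IHt] k x w /=.
  rewrite /undec; congr (_ : bool)%:R; apply/eqP/eqP => [e|->]; last first.
    by apply/ffunP => i; rewrite !ffunE.
  by rewrite -[w]revfK e; apply/ffunP => i; rewrite !ffunE.
rewrite (reindex_inj (inv_inj (@revfK k.+2))); apply: eq_bigr => u _.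
by rewrite IHt transition_rev.
Qed.

Variable P : probability labeling R.
Hypothesis Plaw : has_product_law (fun _ : vertex => label_mass p q) P.

Definition eval (t : nat) (v : vertex) (lab : labeling) : option bool :=
  evolve upd3 (fun=> None) lab t v.

Let mlab (v : vertex) : fin_measurable (fun lab : labeling => lab v) :=
  fin_measurable_coord v.
Let meta (z : int) : fin_measurable (fun _ : labeling => None : B).
Proof. exact: fin_measurable_cst. Qed.
Let indep0 k (x : int) (w : {ffun 'I_k -> B}) (l : seq vertex) (Q : vertex -> pred label) :
  uniq l ->
  pr P ([set _ | win k x (fun=> None) = w] `&` [set lab | forall v, v \in l -> Q v (lab v)]) =
  undec x w * \prod_(v <- l) \sum_(a | Q v a) label_mass p q a.
Proof.
move=> ul; have e : win k x (fun=> None : B) = [ffun=> None].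
  by apply/ffunP => i; rewrite !ffunE.
rewrite e /undec; have [->|nw] := eqVneq w [ffun=> None].
  rewrite mul1r -(product_law_pred Q Plaw ul); congr pr.
  by apply/seteqP; split=> lab //= [].
rewrite mul0r (_ : _ `&` _ = set0) ?pr_set0//.
by apply/seteqP; split=> lab //= [ew]; rewrite ew eqxx in nw.
Qed.

Lemma fin_measurable_eval t v : fin_measurable (eval t v).
Proof. exact: (fin_measurable_evolve upd3 mlab meta). Qed.

Definition br t (x : int) (l : seq (pred (option bool))) : R :=
  pr P [set lab | forall i, (i < size l)%N -> nth isAny l i (eval t (x + i%:Z, 0) lab)].

Lemma measurable_br t x (l : seq (pred (option bool))) :
  measurable [set lab | forall i, (i < size l)%N -> nth isAny l i (eval t (x + i%:Z, 0) lab)].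
Proof.
rewrite (_ : [set lab | _] = \bigcap_(i in [set i | (i < size l)%N])
    [set lab | nth isAny l i (eval t (x + i%:Z, 0) lab)]); last first.
  by apply/seteqP; split=> lab.
apply: fin_bigcap_measurable; first exact: finite_II.
move=> i _; exact: (@fin_measurable_pred _ _ _ _ (fun a => nth isAny l i a)
  (@fin_measurable_eval t _)).
Qed.

Lemma pr_eval_row t k x y (w : {ffun 'I_k -> B}) :
  pr P [set lab | [ffun i : 'I_k => eval t (x + i%:Z, y) lab] = w] = marg t x w.
Proof.
rewrite -(row_law upd3 mlab meta indep0 t x y w); congr pr.
Qed.

(** Past the end of [l] the default [isAny] imposes nothing, so words of different lengths can be
    read in one common window, placed anywhere. *)
Lemma brE t x x' k l : (size l <= k)%N ->
  br t x l = \sum_(u : {ffun 'I_k -> B}) marg t x' u * \prod_(i < k) (nth isAny l i (u i))%:R.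
Proof.
move=> lk.
rewrite /br (pr_partition P (measurable_br t x l)
  (fin_measurable_ffun (fun i : 'I_k => @fin_measurable_eval t (x + i%:Z, 0)))).
apply: eq_bigr => u _; rewrite (marg_shift _ x' x).
have [h|h] := boolP [forall i : 'I_k, nth isAny l i (u i)].
  rewrite big1 => [|i _]; last by rewrite (forallP h i).
  rewrite mulr1 -(pr_eval_row t x 0); congr pr; apply/seteqP; split=> lab /= [] //.
  move=> e; split=> // i il; have ik := leq_trans il lk.
  by have := forallP h (Ordinal ik); rewrite -e ffunE.
have /existsP[i hi] : [exists i : 'I_k, ~~ nth isAny l i (u i)] by rewrite -negb_forall.
rewrite (bigD1 i) //= (negbTE hi) mul0r mulr0 (_ : _ `&` _ = set0) ?pr_set0//.
apply/seteqP; split=> lab //= [+ e].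
have il : (i < size l)%N by rewrite ltnNge; apply: contra hi => il; rewrite nth_default.
by move=> /(_ _ il); move: hi; rewrite -e ffunE => /negbTE ->.
Qed.

Lemma br_split t l1 l2 (A A1 A2 : pred (option bool)) :
  (forall a, A a = A1 a || A2 a) -> (forall a, A1 a -> ~~ A2 a) ->
  br t 0 (l1 ++ A :: l2) = br t 0 (l1 ++ A1 :: l2) + br t 0 (l1 ++ A2 :: l2).
Proof.
move=> AE A12; pose v i lab := eval t (0 + i%:Z, 0) lab.
have nthA (C : pred (option bool)) i : i != size l1 ->
    nth isAny (l1 ++ C :: l2) i = nth isAny (l1 ++ isAny :: l2) i.
  move=> il; rewrite !nth_cat; case: ltnP => // li.
  case e : (i - size l1)%N => [|j] //.
  by case/eqP: il; apply/eqP; rewrite eqn_leq li -subn_eq0 e.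
have setE (C : pred (option bool)) :
    [set lab | forall i, (i < size (l1 ++ C :: l2))%N -> nth isAny (l1 ++ C :: l2) i (v i lab)] =
    [set lab | C (v (size l1) lab) /\ forall i, (i < size l1 + (size l2).+1)%N ->
      i != size l1 -> nth isAny (l1 ++ isAny :: l2) i (v i lab)].
  apply/seteqP; rewrite size_cat /=; split=> lab /=.
    move=> h; split=> [|i il ine]; last by rewrite -(nthA C)//; exact: h.
    have := h (size l1); rewrite nth_cat ltnn subnn /=; apply.
    by rewrite addnS ltnS leq_addr.
  move=> [hC h] i il; have [->|ine] := eqVneq i (size l1); last by rewrite nthA//; exact: h.
  by rewrite nth_cat ltnn subnn.
have mE C := measurable_br t 0 (l1 ++ C :: l2).
rewrite /br /pr -fineD ?fin_num_measure// -measureU//.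
  congr (fine (P _)); rewrite !setE; apply/seteqP; split=> lab /=.
    by rewrite AE => -[/orP[] ? ?]; [left|right].
  by rewrite AE => -[] [-> ?]; rewrite ?orbT.
rewrite !setE; apply/seteqP; split=> lab //= [[a1 _] [a2 _]].
by have := A12 _ a1; rewrite a2.
Qed.

Lemma br_word_prob t : word_prob (br t 0).
Proof.
split.
- by move=> l; exact: pr_ge0.
- move=> l1 l2 sl h; apply: pr_le; [exact: measurable_br|exact: measurable_br|].
  by move=> lab /= hl i; rewrite -sl => il; apply: h; exact: hl.
- by move=> l1 l2; apply: br_split => -[[]|].
- by move=> l1 l2; apply: br_split => -[[]|].
- move=> l; rewrite /br size_rcons; congr pr; apply/seteqP; split=> lab /= h i il.
    by have := h i (ltnW il); rewrite nth_rcons il.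
  rewrite nth_rcons; case: ltnP => [/h //|_]; by case: eqP.
- move=> l; rewrite (@brE t 0 0 (size l)) ?size_rev// [RHS](@brE t 0 0 (size l))//.
  rewrite (reindex_inj (inv_inj (@revfK (size l)))); apply: eq_bigr => u _.
  rewrite marg_rev; congr (_ * _); rewrite (reindex_inj rev_ord_inj).
  apply: eq_bigr => i _; rewrite ffunE rev_ordK nth_rev ?ltn_ord//=.
  by rewrite (_ : (_ - _)%N = i)//; have := ltn_ord i; lia.
Qed.
End Words.

(** * One-step recursion for word probabilities *)

Section Step.
Variables (R : realType) (p q : R).
Local Notation B := (option bool).
Local Notation r := (1 - p - q).
Local Notation s := (1 - q).
Variable P : probability labeling R.
Hypothesis Plaw : has_product_law (fun _ : vertex => label_mass p q) P.
Local Notation br := (br P).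
Local Notation marg := (marginal p q upd3 (@undec R)).

Lemma br_word t (ws : seq (option bool)) :
  br t 0 [seq pred1 a : pred (option bool) | a <- ws] =
  marg t 0 [ffun i : 'I_(size ws) => nth None ws i].
Proof.
rewrite -(pr_eval_row Plaw t 0 0); congr pr; apply/seteqP; split=> lab /=.
  rewrite size_map => h; apply/ffunP => i; rewrite !ffunE.
  by have := h i (ltn_ord i); rewrite (nth_map None)// => /eqP.
move=> /ffunP h i; rewrite size_map => il; rewrite (nth_map None)//=.
by have := h (Ordinal il); rewrite !ffunE => ->.
Qed.

(** The evolution is linear in the word probabilities, so a recursion for them reduces to an
    identity between letter indicators, checked on finitely many letters. *)
Lemma br_step t (ws : seq (option bool)) (L : seq (R * seq (pred (option bool)))) :
  (forall l, l \in map (fun cl => size cl.2) L -> (l <= (size ws).+2)%N) ->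
  (forall a : nat -> B,
    \prod_(0 <= i < size ws) site_law p q upd3 (a i) (a i.+1) (a i.+2) (nth None ws i) =
    \sum_(cl <- L) cl.1 * \prod_(0 <= j < (size ws).+2) (nth isAny cl.2 j (a j))%:R) ->
  br t.+1 0 [seq pred1 a : pred (option bool) | a <- ws] = \sum_(cl <- L) cl.1 * br t 0 cl.2.
Proof.
move=> hL h; rewrite br_word /=.
transitivity (\sum_(u : {ffun 'I_(size ws).+2 -> B}) \sum_(cl <- L)
    marg t (0 - 1) u * (cl.1 * \prod_(i < (size ws).+2) (nth isAny cl.2 i (u i))%:R)).
  apply: eq_bigr => u _; rewrite -mulr_sumr; congr (_ * _).
  have := h (fun j => u (inord j)); rewrite big_mkord => e.
  transitivity (\prod_(i < size ws) site_law p q upd3 (u (inord i)) (u (inord i.+1))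
      (u (inord i.+2)) (nth None ws i)).
    by apply: eq_bigr => i _; rewrite ffunE /nbr addn0 addn1 addn2.
  rewrite e; apply: eq_bigr => cl _; rewrite big_mkord; congr (_ * _).
  by apply: eq_bigr => i _; rewrite inord_val.
have ex (F : {ffun 'I_(size ws).+2 -> B} -> R * seq (pred B) -> R) :
  \sum_u \sum_(cl <- L) F u cl = \sum_(cl <- L) \sum_u F u cl.
  elim: (L) => [|cl L' IHL]; first by rewrite big_nil big1// => u _; rewrite big_nil.
  by rewrite big_cons -IHL -big_split; apply: eq_bigr => u _; rewrite big_cons.
rewrite ex /= big_seq [RHS]big_seq; apply: eq_bigr => cl clL.
rewrite (brE Plaw t 0 (0 - 1) (k := (size ws).+2)); last first.
  by apply: hL; exact: (map_f (fun cl => size cl.2)).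
by rewrite mulr_sumr; apply: eq_bigr => u _; rewrite mulrCA.
Qed.

Lemma br_left t l : br t 0 (isAny :: l) = br t 0 l.
Proof.
have W := br_word_prob Plaw t.
by rewrite -(br_rev W) rev_cons (br_rcons W) (br_rev W).
Qed.

Local Notation Z := isZ.
Local Notation Q := isQ.
Local Notation N := isN.
Local Notation T := isAny.
Local Notation z0 := (Some false).

Ltac expand := rewrite /index_iota /= !(big_cons, big_nil) /= ?(site_law3_zero, site_law3_undec).
Ltac split_letter a i := case: (a i) => [[]|] /=;
  rewrite ?(mul0r, mulr0, mul1r, mulr1, subr0, addr0, add0r).

(** For a letter that enters the identity only through [isN], two cases do instead of three. *)
Ltac split_sign a i := case: (isN (a i)) => /=;
  rewrite ?(mul0r, mulr0, mul1r, mulr1, subr0, addr0, add0r).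

Lemma br_word_step t : word_step p q (br t 0) (br t.+1 0).
Proof.
split.
- apply: etrans (@br_step t [:: None] [:: (r, [:: N; N; N]); (- r, [:: Z; Z; Z])] _ _) _.
  + by move=> l; rewrite !inE => /orP[] /eqP ->.
  + move=> a; expand; move: (1 - p - q) (1 - q) => r' s'. ring.
  + by rewrite !big_cons big_nil /mixed0 /=; ring.
(* A leading [T] aligns a shorter word with the right end of the window; [br_left] deletes it
   afterwards. *)
- apply: etrans (@br_step t [:: z0; None] [::
      (r * s, [:: T; N; N; N]); (- (r * s), [:: T; Z; Z; Z]);
      (- r ^+ 2, [:: N; N; N; N]); (r ^+ 2, [:: N; Z; Z; Z])] _ _) _.
  + by move=> l; rewrite !inE => /or4P[] /eqP ->.
  + move=> a; expand; move: (1 - p - q) (1 - q) => r' s'.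
    by split_letter a 3%N; split_letter a 2%N; split_letter a 1%N; split_letter a 0%N; ring.
  + by rewrite !big_cons big_nil /= !br_left /mixed0 /mixed1; ring.
- apply: etrans (@br_step t [:: z0; z0; None] [::
      (r * s ^+ 2, [:: T; T; N; N; N]); (- (r * s ^+ 2), [:: T; T; Z; Z; Z]);
      (r ^+ 3 - r ^+ 2 * s, [:: N; N; N; N; N]); (r ^+ 2 * s - r ^+ 3, [:: N; N; Z; Z; Z]);
      (- (r ^+ 2 * s), [:: T; N; N; N; N]); (r ^+ 2 * s, [:: T; N; Z; Z; Z])] _ _) _.
  + by move=> l; rewrite !inE; repeat (case/orP => [/eqP -> //|]); move/eqP ->.
  + move=> a; expand; move: (1 - p - q) (1 - q) => r' s'.
    split_letter a 4%N; [by ring| |]; (split_letter a 3%N; try by ring);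
    (split_letter a 2%N; try by ring);
    by split_sign a 1%N; split_sign a 0%N; ring.
  + by rewrite !big_cons big_nil /= !br_left /mixed0 /mixed1 /mixed2; ring.
- apply: etrans (@br_step t [:: z0; z0; z0; None] [::
      (r * s ^+ 3, [:: T; T; T; N; N; N]); (- (r * s ^+ 3), [:: T; T; T; Z; Z; Z]);
      (2 * r ^+ 3 * s - r ^+ 2 * s ^+ 2 - r ^+ 4, [:: N; N; N; N; N; N]);
      (r ^+ 2 * s ^+ 2 - 2 * r ^+ 3 * s + r ^+ 4, [:: N; N; N; Z; Z; Z]);
      (r ^+ 3 * s - r ^+ 2 * s ^+ 2, [:: T; N; N; N; N; N]);
      (r ^+ 2 * s ^+ 2 - r ^+ 3 * s, [:: T; N; N; Z; Z; Z]);
      (- (r ^+ 2 * s ^+ 2), [:: T; T; N; N; N; N]);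
      (r ^+ 2 * s ^+ 2, [:: T; T; N; Z; Z; Z])] _ _) _.
  + by move=> l; rewrite !inE; repeat (case/orP => [/eqP -> //|]); move/eqP ->.
  + move=> a; expand; move: (1 - p - q) (1 - q) => r' s'. (
    split_letter a 5%N; [by ring| |]; (split_letter a 4%N; try by ring);
    (split_letter a 3%N; try by ring);
    by split_sign a 2%N; split_sign a 1%N; split_sign a 0%N; ring).
  + by rewrite !big_cons big_nil /= !br_left /mixed0 /mixed1 /mixed2 /mixed3; ring.
- split.
  (* The factor p is written as s - r, because the check of the letters generalises r and s and
     would lose their relation to p. *)
  + apply: etrans (@br_step t [:: None; z0; None] [::
      (r ^+ 2 * (s - r), [:: N; N; N; N; N]); (- (r ^+ 2 * (s - r)), [:: Z; Z; Z; N; N]);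
      (- (r ^+ 2 * (s - r)), [:: N; N; Z; Z; Z]); (r ^+ 2 * (s - r), [:: Z; Z; Z; Z; Z])] _ _) _.
    * by move=> l; rewrite !inE; repeat (case/orP => [/eqP -> //|]); move/eqP ->.
    * move=> a; expand; move: (1 - p - q) (1 - q) => r' s'.
      split_letter a 4%N; [by ring| |]; (split_letter a 3%N; try by ring);
      (split_letter a 2%N; try by ring);
      by split_letter a 1%N; split_letter a 0%N; ring.
    * by rewrite !big_cons big_nil /= /mixed_overlap; ring.
  + apply: etrans (@br_step t [:: None; z0; z0; None] [::
      (r ^+ 2 * (s - r) ^+ 2, [:: N; N; N; N; N; N]);
      (- (r ^+ 2 * (s - r) ^+ 2), [:: Z; Z; Z; N; N; N]);
      (- (r ^+ 2 * (s - r) ^+ 2), [:: N; N; N; Z; Z; Z]);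
      (r ^+ 2 * (s - r) ^+ 2, [:: Z; Z; Z; Z; Z; Z])] _ _) _.
    * by move=> l; rewrite !inE; repeat (case/orP => [/eqP -> //|]); move/eqP ->.
    * move=> a; expand; move: (1 - p - q) (1 - q) => r' s'. (
      split_letter a 5%N; [by ring| |]; (split_letter a 4%N; try by ring);
      (split_letter a 3%N; try by ring); (split_letter a 2%N; try by ring);
      (split_letter a 1%N; try by ring); split_letter a 0%N; by ring).
    * by rewrite !big_cons big_nil /= /mixed_pair; ring.
Qed.
End Step.

(** * Comparison of the three-valued recursion with other starts *)

Section Coupling.
Variables (B : alphabetType) (e : bool -> B).

(** The information order, with ? below everything. The embedding [e] lets one argument serve both
    alphabets. *)
Definition refines (a : option bool) (b : B) : Prop := if a is Some c then b = e c else True.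

Variable upd : label -> B -> B -> B -> B.
Hypothesis upd_refines : forall l a b c a' b' c', refines a a' -> refines b b' ->
  refines c c' -> refines (upd3 l a b c) (upd l a' b' c').

Lemma evolve_refines (eta : int -> B) lab t v :
  refines (evolve upd3 (fun=> None) lab t v) (evolve upd eta lab t v).
Proof. by elim: t v => [//|t IHt] v /=; exact: upd_refines. Qed.
End Coupling.

Lemma upd3_refines l a b c (a' b' c' : option bool) : refines Some a a' -> refines Some b b' ->
  refines Some c c' -> refines Some (upd3 l a b c) (upd3 l a' b' c').
Proof.
case: l => //=; move: a b c a' b' c'.
by move=> [[]|] [[]|] [[]|] [[]|] [[]|] [[]|] /= h1 h2 h3; rewrite /nor3 //=; congruence.
Qed.

(** Running t + 1 steps amounts to running t steps from a row that refines ? everywhere. *)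
Lemma eval_next t v lab b : eval t v lab = Some b -> eval t.+1 v lab = Some b.
Proof.
have : refines Some (eval t v lab) (eval t.+1 v lab).
  by elim: t v => [//|t IHt] v; apply: upd3_refines; exact: IHt.
by move=> + e; rewrite e.
Qed.

Lemma eval_mono s t v lab b : (s <= t)%N -> eval s v lab = Some b -> eval t v lab = Some b.
Proof.
move=> /subnKC <-; elim: (t - s)%N => [|n IHn] h; first by rewrite addn0.
by rewrite addnS; exact/eval_next/IHn.
Qed.

Section Decay.
Variables (R : realType) (p q : R).
Hypotheses (hp : 0 <= p) (hq : 0 <= q) (hpq : 0 < p + q) (hpq1 : p + q <= 1).
Variable P : probability labeling R.
Hypothesis Plaw : has_product_law (fun _ : vertex => label_mass p q) P.

Definition undecided t := br P t 0 [:: isQ].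

Lemma pr_undecided t v : pr P [set lab | eval t v lab = None] = undecided t.
Proof.
pose w : {ffun 'I_1 -> option bool} := [ffun=> None].
transitivity (marginal p q upd3 (@undec R) t v.1 w).
  rewrite -(pr_eval_row Plaw t v.1 v.2 w); congr pr.
  have ev : (v.1 + (ord0 : 'I_1)%:Z, v.2) = v by case: (v) => x y /=; rewrite addr0.
  apply/seteqP; split=> lab /= => [h|/ffunP/(_ ord0)].
    by apply/ffunP => i; rewrite !ffunE ord1 ev.
  by rewrite !ffunE ev.
rewrite (marg_shift _ _ _ v.1 0) -(pr_eval_row Plaw t 0 0 w); congr pr.
apply/seteqP; split=> lab /=.
  move=> /ffunP/(_ ord0); rewrite !ffunE => h [|i]//= _.
  by rewrite /isQ /= h.
move=> /(_ 0%N isT) /eqP h; apply/ffunP => i; rewrite !ffunE ord1; exact: h.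
Qed.

Lemma undecided_ge0 t : 0 <= undecided t. Proof. exact: pr_ge0. Qed.

Lemma undecided_decr t : undecided t.+1 <= undecided t.
Proof.
rewrite -(pr_undecided _ (0, 0)) -(pr_undecided t (0, 0)).
apply: pr_le; [exact: fin_measurable_eval|exact: fin_measurable_eval|].
move=> lab /= h; case e : (eval t (0, 0) lab) => [b|//].
by rewrite (eval_next e) in h.
Qed.

Lemma br_le1 t l : br P t 0 l <= 1.
Proof. by apply: pr_le1; exact: measurable_br. Qed.

(** Since g lies in [-1, 1], the extremes are 1 + 2 + 2 + 2 = 7 and -2 - 1 - 2 = -5. *)
Lemma weight_bound t : -5 <= weight p q (br P t 0) <= 7.
Proof.
have hb l : 0 <= br P t 0 l <= 1 by rewrite pr_ge0 br_le1.
have aux (g b1 b2 b3 b4 b5 b6 : R) : -1 <= g -> g <= 1 -> 0 <= b1 <= 1 -> 0 <= b2 <= 1 ->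
    0 <= b3 <= 1 -> 0 <= b4 <= 1 -> 0 <= b5 <= 1 -> 0 <= b6 <= 1 ->
    -5 <= b1 + 2 * b2 + 2 * b3 - 2 * g * b4 - b5 - 2 * b6 <= 7.
  move=> g1 g2 h1 h2 h3 /andP[h4 h4'] h5 h6.
  have : 0 <= (1 - g) * b4 by apply: mulr_ge0 => //; lra.
  have : 0 <= (1 + g) * b4 by apply: mulr_ge0 => //; lra.
  by move=> u1 u2; lra.
move: (hp) (hq) (hpq1) => hp' hq' hpq'.
have p2 : 0 <= p ^+ 2 <= p by rewrite exprn_ge0// expr2 ler_piMr//; lra.
by apply: aux => //; lra.
Qed.

Lemma kappa_gt0 : 0 < kappa p q.
Proof. by rewrite /kappa divr_gt0// exprn_gt0. Qed.

Lemma undecided_bound t : t%:R * (kappa p q * undecided t) <= 12.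
Proof.
suff : t%:R * (kappa p q * undecided t) <= weight p q (br P 0 0) - weight p q (br P t 0).
  by have := weight_bound 0; have := weight_bound t; lra.
elim: t => [|t IHt]; first by rewrite mul0r subrr.
have := weight_decr (br_word_prob Plaw t) hp hq hpq1 (br_word_step Plaw t).
rewrite -/(undecided t); have := ler_wpM2l (ltW kappa_gt0) (undecided_decr t).
move=> h1 h2; have := ler_wpM2l (ler0n R t) h1.
by rewrite -natr1 mulrDl mul1r; lra.
Qed.

Lemma undecided_small (e : R) : 0 < e -> exists t, forall s, (t <= s)%N -> undecided s < e.
Proof.
move=> e0; pose C := 12 / (kappa p q * e).
have ke : 0 < kappa p q * e by rewrite mulr_gt0// kappa_gt0.
exists (Num.bound C) => s hs.
have hC : C < s%:R.
  apply: lt_le_trans (_ : (Num.bound C)%:R <= _); last by rewrite ler_nat.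
  by apply: archi_boundP; rewrite divr_ge0// ltW.
rewrite ltNge; apply/negP => es; have := undecided_bound s.
have : C * (kappa p q * e) < s%:R * (kappa p q * e) by rewrite ltr_pM2r.
rewrite /C divfK ?gt_eqF// => h1.
have h2 : s%:R * (kappa p q * e) <= s%:R * (kappa p q * undecided s).
  apply: ler_wpM2l; first exact: ler0n.
  by apply: ler_wpM2l => //; exact/ltW/kappa_gt0.
lra.
Qed.
End Decay.

(** * The game *)

Section Game.
Variable lab : labeling.
Local Notation ev t v := (eval t v lab).

Lemma eval_open t v b : lab v = Open -> (ev t.+1 v = Some b) <->
  if b then forall c, c \in Out_V4 v -> ev t c = Some false
  else exists2 c, c \in Out_V4 v & ev t c = Some true.
Proof.
move=> lv; set c1 := (v.1 - 1, v.2 + 1); set c2 := (v.1, v.2 + 1); set c3 := (v.1 + 1, v.2 + 1).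
have -> : eval t.+1 v lab = nor3 (ev t c1) (ev t c2) (ev t c3) by rewrite /eval /= lv.
rewrite /nor3 /Out_V4 -/c1 -/c2 -/c3; case: b; split.
- move=> h c; rewrite !inE => /or3P[] /eqP ->; move: h;
  by case: (ev t c1) => [[]|]; case: (ev t c2) => [[]|]; case: (ev t c3) => [[]|].
- by move=> h; rewrite (h c1) ?inE ?eqxx// (h c2) ?inE ?eqxx ?orbT// (h c3) ?inE ?eqxx ?orbT.
- case: ifP => [/or3P[] /eqP h _|_]; last by case: ifP.
  + by exists c1; rewrite ?inE ?eqxx.
  + by exists c2; rewrite ?inE ?eqxx ?orbT.
  + by exists c3; rewrite ?inE ?eqxx ?orbT.
- by move=> [c]; rewrite !inE => /or3P[] /eqP -> ->; rewrite ?eqxx ?orbT.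
Qed.

Lemma eval_label t v : ev t.+1 v = match lab v with
  | Trap => Some false | Target => Some true | Open => ev t.+1 v end.
Proof. by rewrite /eval /=; case: (lab v). Qed.

Definition first_out (v : vertex) : vertex := (v.1 - 1, v.2 + 1).
Lemma first_outP v : first_out v \in Out_V4 v. Proof. by rewrite inE eqxx. Qed.

(** One positional strategy that realises [Q] wherever some legal move does. *)
Lemma choose_out (Q : vertex -> vertex -> Prop) : exists f : vertex -> vertex,
  (forall v, f v \in Out_V4 v) /\ forall v c, c \in Out_V4 v -> Q v c -> Q v (f v).
Proof.
have /choice[f hf] : forall v, exists c, c \in Out_V4 v /\
    forall c', c' \in Out_V4 v -> Q v c' -> Q v c.
  move=> v; have [[c [co Qc]]|h] := pselect (exists c, c \in Out_V4 v /\ Q v c).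
    by exists c.
  by exists (first_out v); split=> [|c co Qc]; [exact: first_outP|case: h; exists c].
by exists f; split=> [v|v c co Qc]; case: (hf v) => // _ /(_ c co Qc).
Qed.

Lemma position_legal s v n : legal Out_V4 (s false) -> legal Out_V4 (s true) ->
  position s v n.+1 \in Out_V4 (position s v n).
Proof.
rewrite /position /=; case: (play s v n) => u past lf lt /=.
by case: (odd n); [exact: lt|exact: lf].
Qed.

Lemma position_positional s v n (f : vertex -> vertex) :
  (forall u past, s (odd n) u past = f u) -> position s v n.+1 = f (position s v n).
Proof. by rewrite /position /=; case: (play s v n) => u past ->. Qed.

(* The winner always moves to a vertex that is decided as a loss one step earlier than
   the current vertex is decided, so the play ends. *)
Lemma eval_wins t v (w : bool) : lab v = Open -> ev t v = Some w -> player_wins Out_V4 lab w v.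
Proof.
move=> lv ew.
(* A positional strategy cannot know the number of moves left, so it aims at the least time at which
   the current vertex is decided as a win for the mover. *)
have rankP u : exists m, forall k, ev k u = Some false -> (m <= k)%N /\ ev m u = Some false.
  have [[k ek]|h] := pselect (exists k, ev k u = Some false).
    have ex : exists k, ev k u == Some false by exists k; exact/eqP.
    exists (ex_minn ex) => k' /eqP ek'; case: ex_minnP => m /eqP em hm; split=> //; exact: hm.
  by exists 0%N => k ek; case: h; exists k.
have /choice[rank hrank] := rankP.
have [f [fo fQ]] := choose_out (fun u c => ev (rank u).-1 c = Some true).
exists (fun u _ => f u); split=> [u past|so hso]; first exact: fo.
set s := fun i => if i == w then _ else _.
have lf : legal Out_V4 (s false) by rewrite /s; case: eqP => // _ ? ?; exact: fo.
have lt : legal Out_V4 (s true) by rewrite /s; case: eqP => // _ ? ?; exact: fo.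
(* [m] bounds the number of moves left, and the value says that the mover wins if the mover is [w]
   and loses otherwise. The case m = 0 cannot occur, as nothing is decided at time 0. *)
suff main m n : (forall k, (0 < k <= n)%N -> lab (position s v k) = Open) ->
    lab (position s v n) = Open -> ev m (position s v n) = Some (odd n != w) ->
    play_won lab w s v.
  apply: (main t 0%N) => //; last by rewrite /position /= ew; case: (w).
  by move=> k /andP[k0]; rewrite leqNgt k0.
elim: m n => [//|m IHm] n hopen hn hev.
have hnext : ev m (position s v n.+1) = Some (odd n.+1 != w).
  have po := position_legal v n lf lt.
  move: hev => /=; have [ow|ow] /= := eqVneq (odd n) w.
    move=> hev; rewrite (@position_positional s v n f); last by move=> u past; rewrite /s ow eqxx.
    have [rm rk] := hrank _ _ hev.
    case er : (rank (position s v n)) rm rk => [//|m'] rm rk.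
    have [c co cQ] := (eval_open m' false hn).1 rk.
    have := fQ _ _ co; rewrite er /= => /(_ cQ) h.
    have -> : (~~ odd n != w) = true by rewrite ow; case: (w).
    exact: eval_mono h.
  move=> /(eval_open m true hn) /(_ _ po) ->; congr Some.
  by move: ow; case: (odd n); case: (w).
case lc : (lab (position s v n.+1)); last first.
- apply: (IHm n.+1) => // k /andP[k0]; rewrite leq_eqVlt => /orP[/eqP -> //|].
  by rewrite ltnS => kn; apply: hopen; rewrite k0.
- exists n; split=> //; rewrite lc /winning_label.
  have := eval_next hnext; rewrite eval_label lc => -[] /=.
  by case: (odd n); case: (w).
- exists n; split=> //; rewrite lc /winning_label.
  have := eval_next hnext; rewrite eval_label lc => -[] /=.
  by case: (odd n); case: (w).
Qed.

(* The opponent avoids the vertices that are ever decided in favour of [w]. *)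
Lemma undecided_no_win v (w : bool) : (forall t, ev t v = None) -> ~ player_wins Out_V4 lab w v.
Proof.
move=> hv [sw [lsw win]].
have [f [fo fQ]] := choose_out (fun _ c => forall t, ev t c <> Some false).
have := win (fun u _ => f u) (fun u _ => fo u).
set s := fun i => if i == w then _ else _.
have lf : legal Out_V4 (s false) by rewrite /s; case: eqP => // _ ? ?; exact: fo.
have lt : legal Out_V4 (s true) by rewrite /s; case: eqP => // _ ? ?; exact: fo.
have lv : lab v = Open by have := hv 1%N; rewrite eval_label; case: (lab v).
move=> [n [hopen hn]].
(* Undecidedness itself need not persist, since [w] may blunder. The invariant only says that the
   position is never decided in favour of [w]. *)
have main k : (k <= n.+1)%N -> forall t, ev t (position s v k) <> Some (odd k != w).
  elim: k => [_ t|k IHk kn]; first by rewrite hv.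
  have {}IHk := IHk (ltnW kn).
  have lk : lab (position s v k) = Open by case: k kn {IHk} => // k kn; exact: hopen.
  have po := position_legal v k lf lt.
  move: IHk; have [ow|ow] /= := eqVneq (odd k) w => IHk.
    move=> t; have -> : (~~ odd k != w) = true by rewrite ow; case: (w).
    by move=> h; apply: (IHk t.+1); apply/(eval_open t false lk); exists (position s v k.+1).
  have -> : (~~ odd k != w) = false by move: ow; case: (odd k); case: (w).
  rewrite (@position_positional s v k f); last by move=> u past; rewrite /s (negbTE ow).
  have [[c co hc]|nc] := pselect (exists2 c, c \in Out_V4 (position s v k) &
      forall t, ev t c <> Some false); first exact: fQ co hc.
  have hall c : c \in Out_V4 (position s v k) -> exists t, ev t c = Some false.
    move=> co; apply: contrapT => h; apply: nc; exists c => // t ht; apply: h; by exists t.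
  move: hall; set u := position s v k => hall.
  (* Finite branching: if each of the three successors is decided as 0 at some time, then one step
     after the latest of these times the position itself is decided in favour of [w]. *)
  have [t1 h1] := hall (u.1 - 1, u.2 + 1) (mem_head _ _).
  have [t2 h2] : exists t, ev t (u.1, u.2 + 1) = Some false by apply: hall; rewrite !inE eqxx orbT.
  have [t3 h3] : exists t, ev t (u.1 + 1, u.2 + 1) = Some false.
    by apply: hall; rewrite !inE eqxx !orbT.
  case: (IHk (maxn t1 (maxn t2 t3)).+1); apply/(eval_open _ true lk) => c.
  rewrite !inE => /or3P[] /eqP ->.
  - by apply: eval_mono h1; rewrite leq_max leqnn.
  - by apply: eval_mono h2; rewrite !leq_max leqnn orbT.
  - by apply: eval_mono h3; rewrite !leq_max leqnn !orbT.
have := main n.+1 (leqnn _) 1%N; rewrite eval_label hn /winning_label /=.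
by case: (odd n); case: (w) => /=; apply.
Qed.

Lemma class_DE v : class_D Out_V4 lab v <-> forall t, ev t v = None.
Proof.
split=> [[nW nL] t|hv].
  case e : (ev t v) => [[]|//]; exfalso; move: (eval_next e); rewrite eval_label.
    case lv : (lab v) => // _; apply: nL; [by left|right; split=> //].
    exact: (eval_wins lv e).
  case lv : (lab v) => // _; apply: nW; [by left|right; split=> //].
  exact: (eval_wins lv e).
have lv : lab v = Open by have := hv 1%N; rewrite eval_label; case: (lab v).
by split; rewrite /class_W /class_L lv => -[//|[_]]; exact: undecided_no_win.
Qed.
End Game.

Lemma draw_null (R : realType) (p q : R) (P : probability labeling R) v :
  0 <= p -> 0 <= q -> 0 < p + q -> p + q <= 1 ->
  has_product_law (fun _ : vertex => label_mass p q) P ->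
  measurable [set lab : labeling | class_D Out_V4 lab v] /\
  P [set lab : labeling | class_D Out_V4 lab v] = 0%E.
Proof.
move=> hp hq hpq hpq1 Plaw.
have DE : [set lab : labeling | class_D Out_V4 lab v] =
    \bigcap_t [set lab | eval t v lab = None].
  apply/seteqP; split=> lab /=; first by move=> /class_DE h t _; exact: h.
  by move=> h; apply/class_DE => t; exact: h.
have mD : measurable [set lab : labeling | class_D Out_V4 lab v].
  by rewrite DE; apply: bigcapT_measurable => t; exact: fin_measurable_eval.
split=> //; rewrite (prE P mD); congr EFin; apply/eqP; rewrite eq_le pr_ge0 andbT.
rewrite leNgt; apply/negP => h.
have [t ht] := undecided_small hp hq hpq hpq1 Plaw h.
have := ht t (leqnn t); rewrite ltNge => /negP; apply.
rewrite -(pr_undecided Plaw t v); apply: pr_le => //; first exact: fin_measurable_eval.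
by rewrite DE => lab; exact.
Qed.

(** * Weak convergence *)

Section WeakConvergence.
Variables (R : realType) (A : alphabetType).
Local Notation configZ := (config int A).
Local Notation ptwsZ := {ptws int -> discrete_topology A}.

Definition agree n (eta zeta : int -> A) := forall z, (absz z <= n)%N -> zeta z = eta z.

Lemma nbhs_agree n (eta : ptwsZ) : nbhs eta [set zeta : ptwsZ | agree n eta zeta].
Proof.
have nz (z : int) : nbhs eta [set zeta : ptwsZ | zeta z = eta z].
  have := @proj_continuous int (fun=> discrete_topology A) z eta [set eta z].
  by apply; exact: discrete_set1.
elim: n => [|n IHn].
  by apply: filterS (nz 0) => zeta /= h z; rewrite leqn0 absz_eq0 => /eqP ->.
apply: filterS (filterI IHn (filterI (nz n.+1%:Z) (nz (- n.+1%:Z)))) => zeta /= [h1 [h2 h3]] z.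
rewrite leq_eqVlt ltnS => /orP[/eqP zn|]; last exact: h1.
by have [->|->] : z = n.+1%:Z \/ z = - n.+1%:Z by lia.
Qed.

Lemma agree_cvg (F : set_system ptwsZ) (eta : ptwsZ) : Filter F ->
  (forall n, F [set zeta | agree n eta zeta]) -> F --> eta.
Proof.
move=> FF h; apply/cvg_sup => z W.
rewrite (@nbhsE (initial_topology (fun g : (forall _ : int, discrete_topology A) => g z))).
move=> -[V [[C oC <-] Vz] VW].
apply: filterS (h (absz z)) => zeta /(_ z (leqnn _)) e; apply: VW.
by rewrite /= e.
Qed.

Definition trunc n (eta : int -> A) : int -> A := unwin (win n.*2.+1 (- n%:Z) eta).

Lemma agree_trunc m n eta : (m <= n)%N -> agree m eta (trunc n eta).
Proof. by move=> mn z zm; rewrite /trunc unwin_win//; exact: leq_trans zm mn. Qed.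

Variable f : ptwsZ -> R.
Hypothesis cf : continuous f.

Lemma continuous_agree (eta : ptwsZ) (e : R) : 0 < e ->
  exists n, forall zeta, agree n eta zeta -> `|f eta - f zeta| < e.
Proof.
move=> e0; apply: contrapT => H.
have /choice[zs hz] : forall n, exists zeta, agree n eta zeta /\ e <= `|f eta - f zeta|.
  move=> n; apply: contrapT => hn; apply: H; exists n => zeta az.
  by rewrite ltNge; apply/negP => ez; apply: hn; exists zeta.
have zcvg : zs @ \oo --> (eta : ptwsZ).
  apply: agree_cvg => n; exists n => // k /= nk z zn.
  by have [hk _] := hz k; apply: hk; exact: leq_trans zn nk.
have /cvgrPdist_lt/(_ e e0)[n _ hn] : f (zs n) @[n --> \oo] --> f eta.
  by apply: (cvg_comp _ _ zcvg); exact: cf.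
by have := hn n (leqnn n); have [_ ] := hz n; rewrite leNgt => /negP.
Qed.

(** Uniform continuity by compactness: counterexamples for all n would cluster at some [eta], near
    which both they and their truncations have values close to f eta. *)
Lemma uniform_trunc (e : R) : 0 < e -> exists n, forall eta, `|f eta - f (trunc n eta)| < e.
Proof.
move=> e0; apply: contrapT => H.
have /choice[zs hz] : forall n, exists eta : ptwsZ, e <= `|f eta - f (trunc n eta)|.
  move=> n; apply: contrapT => hn; apply: H; exists n => eta.
  by rewrite ltNge; apply/negP => ez; apply: hn; exists eta.
have cT : compact [set g : ptwsZ | forall z, [set: discrete_topology A] (g z)].
  apply: (@tychonoff int (fun=> discrete_topology A) (fun=> setT)) => z.
  by apply: finite_compact; exact: finite_finset.
have [eta [_ ceta]] := cT (zs @ \oo) _ (filterS (fun g _ z => Logic.I) (@filterT _ (zs @ \oo) _)).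
have e2 : 0 < e / 2 by rewrite divr_gt0.
have [N hN] := continuous_agree eta e2.
have FN : (zs @ \oo) [set zeta | exists2 n, (N <= n)%N & zeta = zs n].
  by exists N => // n /= Nn; exists n.
have [zeta [[n Nn ->] az]] := ceta _ _ FN (nbhs_agree N eta).
have at' : agree N eta (trunc n (zs n)).
  move=> z zN; rewrite -(az z zN); apply: (agree_trunc (zs n) Nn); exact: zN.
have := hz n; rewrite leNgt => /negP; apply.
have := ler_distD (f eta) (f (zs n)) (f (trunc n (zs n))).
have := hN _ az; have := hN _ at'; rewrite (distrC (f (zs n)) (f eta)).
set x := `|_|; set y := `|_|; set w := `|_|; lra.
Qed.

Lemma measurable_cylinder_fun n : measurable_fun setT (fun eta : configZ => f (trunc n eta)).
Proof.
move=> _ Y mY; rewrite setTI.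
exact: (@fin_measurable_pred _ _ _ _ (fun w => Y (f (unwin w)))
  (@fin_measurable_win A n.*2.+1 (- n%:Z))).
Qed.

(** The sigma-algebra is generated by coordinates, not by open sets; [f] is a pointwise limit of
    functions of finitely many coordinates. *)
Lemma measurable_continuous : measurable_fun setT (f : configZ -> R).
Proof.
apply: (measurable_fun_cvg (h := fun n (eta : configZ) => f (trunc n eta))).
  exact: measurable_cylinder_fun.
move=> eta _; apply/cvgrPdist_lt => e e0.
have [N hN] := continuous_agree eta e0.
by exists N => // n /= Nn; apply: hN; exact: agree_trunc.
Qed.

Hypothesis bf : exists M, forall eta, `|f eta| <= M.

Lemma integrable_continuous (mu : probability configZ R) :
  mu.-integrable setT (EFin \o (f : configZ -> R)).
Proof.
apply: measurable_bounded_integrable => //.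
- exact: (le_lt_trans (probability_le1 mu measurableT) (ltry 1)).
- exact: measurable_continuous.
- have [M hM] := bf; exists M; split; first exact: num_real.
  by move=> x Mx eta _ /=; apply: le_trans (hM eta) _; exact: ltW.
Qed.

Definition cylinder_mean n (mu : probability configZ R) : R :=
  \sum_(w : {ffun 'I_n.*2.+1 -> A}) f (unwin w) *
    pr mu [set eta | win n.*2.+1 (- n%:Z) eta = w].

(** The constant [c] takes the values e and -e of the truncation error, so that integrals can be
    compared by monotonicity. *)
Lemma integral_cylinder n (c : R) (mu : probability configZ R) :
  (\int[mu]_(eta in setT) (f (trunc n eta) + c)%:E = (cylinder_mean n mu + c)%:E)%E.
Proof.
rewrite (integral_fin mu (fun w => f (unwin w) + c) (@fin_measurable_win A n.*2.+1 (- n%:Z))).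
congr EFin; under eq_bigr do rewrite mulrDl; rewrite big_split; congr (_ + _).
rewrite /= -mulr_sumr -[RHS]mulr1; congr (_ * _); rewrite -(pr_setT mu).
rewrite (pr_partition mu measurableT (@fin_measurable_win A n.*2.+1 (- n%:Z))).
by apply: eq_bigr => w _; rewrite setTI.
Qed.

Definition mean (mu : probability configZ R) : R := fine (\int[mu]_eta (f eta)%:E)%E.

Lemma meanE (mu : probability configZ R) : (\int[mu]_eta (f eta)%:E = (mean mu)%:E)%E.
Proof. by rewrite /mean fineK//; apply: integrable_fin_num => //; exact: integrable_continuous. Qed.

Lemma mean_cylinder n (e : R) : (forall eta, `|f eta - f (trunc n eta)| < e) ->
  forall mu, `|mean mu - cylinder_mean n mu| <= e.
Proof.
move=> hn mu.
have ib c : mu.-integrable setT (fun eta : configZ => (f (trunc n eta) + c)%:E).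
  apply: (@measurable_bounded_integrable _ _ _ _ (fun eta : configZ => f (trunc n eta) + c)) => //.
  - exact: (le_lt_trans (probability_le1 mu measurableT) (ltry 1)).
  - by apply: measurable_funD => //; exact: measurable_cylinder_fun.
  - have [M hM] := bf; exists (M + `|c|); split; first exact: num_real.
    move=> x Mx eta _ /=; apply: le_trans (ler_normD _ _) _.
    by apply: le_trans (ltW Mx); rewrite lerD2r; exact: hM.
have h (eta : configZ) : - e < f eta - f (trunc n eta) < e by rewrite -ltr_norml.
have u1 : mean mu <= cylinder_mean n mu + e.
  rewrite -lee_fin -meanE -integral_cylinder.
  apply: (@le_integral _ _ _ mu setT _ (EFin \o (f : configZ -> R))) => //.
  - exact: integrable_continuous.
  - by move=> eta _; rewrite lee_fin; have /andP[] := h eta; lra.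
have u2 : cylinder_mean n mu - e <= mean mu.
  rewrite -lee_fin -meanE -integral_cylinder.
  apply: (@le_integral _ _ _ mu setT _ _ (EFin \o (f : configZ -> R))) => //.
  - exact: integrable_continuous.
  - by move=> eta _; rewrite lee_fin; have /andP[] := h eta; lra.
by rewrite ler_norml; apply/andP; split; lra.
Qed.
End WeakConvergence.

(** Up to a uniform error [f] is a cylinder function, whose mean is a finite combination of window
    probabilities; an e/3 argument concludes. *)
Lemma cvg_weakly_win (R : realType) (F : pca R)
    (nu : nat -> probability (config int (alphabet F)) R)
    (mu : probability (config int (alphabet F)) R) :
  (forall k x (w : {ffun 'I_k -> alphabet F}),
    pr (nu t) [set eta | win k x eta = w] @[t --> \oo] --> pr mu [set eta | win k x eta = w]) ->
  cvg_weakly nu mu.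
Proof.
move=> H f cf bf.
rewrite (meanE cf bf) (_ : (fun t => _) = (fun t => (mean f (nu t))%:E)); last first.
  by apply/funext => t; rewrite (meanE cf bf).
apply: cvg_EFin; first by near=> t.
rewrite /comp /=; apply/cvgrPdist_le => e e0.
have e3 : 0 < e / 3 by rewrite divr_gt0.
have [n hn] := uniform_trunc cf e3.
have hm := mean_cylinder cf bf hn.
have : cylinder_mean f n (nu t) @[t --> \oo] --> cylinder_mean f n mu.
  by apply: cvg_big => [|w _]; [exact: add_continuous|apply: cvgMl_tmp; exact: H].
move/cvgrPdist_le => /(_ _ e3) [N _ hN]; exists N => // t /= Nt.
have := hN t Nt; have := hm mu; have := hm (nu t).
rewrite !ler_norml => /andP[? ?] /andP[? ?] /andP[? ?]; apply/andP; split; lra.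
Unshelve. all: by end_near. Qed.

(** * Ergodicity *)

Section Ergodicity.
Variables (R : realType) (p q : R).
Hypotheses (hp : 0 <= p) (hq : 0 <= q) (hpq : 0 < p + q) (hpq1 : p + q <= 1).
Variables (B : alphabetType) (e : bool -> B) (upd : label -> B -> B -> B -> B).
Hypothesis upd_refines : forall l a b c a' b' c', refines e a a' -> refines e b b' ->
  refines e c c' -> refines e (upd3 l a b c) (upd l a' b' c').
Variable rl : 3.-tuple B -> B -> R.
Hypothesis rlE : forall a b, rl a b =
  site_law p q upd (tnth a ord0) (tnth a (inord 1)) (tnth a (inord 2)) b.
Variable P : probability labeling R.
Hypothesis Plaw : has_product_law (fun _ : vertex => label_mass p q) P.

Local Notation configZ := (config int B).
Local Notation iterate := (iterate upd P).

(** A site that is never decided receives [e false]; this has probability 0. *)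
Definition limit_config (lab : labeling) : configZ :=
  fun x => e `[< exists t, eval t (x, 0) lab = Some true >].

Lemma measurable_limit_config : measurable_fun setT limit_config.
Proof.
apply: measurable_config => x.
apply: (@fin_measurable_comp _ _ _ _ e
  (fun lab : labeling => `[< exists t, eval t (x, 0) lab = Some true >])).
have mU : measurable (\bigcup_t [set lab : labeling | eval t (x, 0) lab = Some true]).
  by apply: bigcupT_measurable => t; exact: fin_measurable_eval.
case.
  move: mU; congr (measurable _); apply/seteqP; split=> lab /=.
    by move=> [t _ h]; apply/asboolT; exists t.
  by move=> /asboolP[t h]; exists t.
move: (measurableC mU); congr (measurable _); apply/seteqP; split=> lab /=.
  by move=> h; apply/asboolF => -[t ht]; apply: h; exists t.
by move=> /asboolP h [t _ ht]; apply: h; exists t.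
Qed.

Definition limit_law : probability configZ R := law P measurable_limit_config.

Lemma decided_limit eta lab t x b : eval t (x, 0) lab = Some b ->
  evolve upd eta lab t (x, 0) = limit_config lab x.
Proof.
move=> h; have := evolve_refines upd_refines eta lab t (x, 0).
rewrite -/(eval t (x, 0) lab) h /= => ->; rewrite /limit_config; congr e; apply/esym.
case: b h => h; first by apply/asboolT; exists t.
apply/asboolF => -[t' h'].
have := eval_mono (leq_maxl t t') h; have := eval_mono (leq_maxr t t') h'.
by move=> ->.
Qed.

(** Both configurations are built from the same labels and agree at every site decided by time [t],
    so a union bound over the k sites of the window suffices. *)
Lemma iterate_limit (nu : probability configZ R) t k x (w : {ffun 'I_k -> B}) :
  `|pr (iterate nu t) [set eta | win k x eta = w] - pr limit_law [set eta | win k x eta = w]|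
  <= k%:R * undecided P t.
Proof.
rewrite (iterate_prod upd Plaw) pr_law.
set S2 := _ @^-1` _; set PP := product_probability nu P.
have mS2 : measurable S2.
  rewrite /S2 -[X in measurable X]setTI; apply: measurable_limit_config => //.
  exact: (fin_measurable_win x w).
have -> : pr P S2 = pr PP (setT `*` S2) by rewrite pr_prodX// pr_setT mul1r.
pose bad (i : 'I_k) : set (configZ * labeling) :=
  setT `*` [set lab | eval t (x + i%:Z, 0) lab = None].
have mbad i : measurable (bad i) by apply: measurableX => //; exact: fin_measurable_eval.
have mB : measurable [set o | exists i, bad i o].
  rewrite (_ : [set o | _] = \bigcup_(i in [set: 'I_k]) bad i).
    by apply: fin_bigcup_measurable => [|i _] //; exact: finite_finset.
  by apply/seteqP; split=> o [i]; [exists i|move=> _ ?; exists i].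
have good (o : configZ * labeling) : ~ (exists i, bad i o) ->
    win k x (fun z => evolve upd o.1 o.2 t (z, 0)) = win k x (limit_config o.2).
  move=> h; apply/ffunP => i; rewrite !ffunE.
  case ei : (eval t (x + i%:Z, 0) o.2) => [b|]; first exact: (decided_limit _ ei).
  by case: h; exists i.
apply: (@le_trans _ _ (pr PP [set o | exists i, bad i o])).
  apply: pr_close => //.
  - have m : measurable_fun setT (evolve_config upd t) by exact: measurable_evolve_config.
    have := @fin_measurable_fun _ _ _ _ _ _ _ m (@fin_measurable_win B k x) w.
    by [].
  - exact: measurableX.
  - move=> o /= h; have [bo|/good g] := pselect (exists i, bad i o); first by right.
    by left; split=> //; rewrite /S2 /= -g.
  - move=> o /= [_ h]; have [bo|/good g] := pselect (exists i, bad i o); first by right.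
    by left; rewrite g.
apply: (le_trans (pr_bigcup_ord PP mbad)).
rewrite (eq_bigr (fun=> undecided P t)) => [|i _].
  by rewrite sumr_const card_ord mulr_natl.
rewrite pr_prodX//; last exact: fin_measurable_eval.
by rewrite pr_setT mul1r (pr_undecided Plaw).
Qed.

Lemma iterate_cvg (nu : probability configZ R) k x (w : {ffun 'I_k -> B}) :
  pr (iterate nu t) [set eta | win k x eta = w] @[t --> \oo] -->
  pr limit_law [set eta | win k x eta = w].
Proof.
apply/cvgrPdist_lt => ep ep0.
have ek : 0 < ep / k.+1%:R by rewrite divr_gt0.
have [N hN] := undecided_small hp hq hpq hpq1 Plaw ek.
exists N => // t /= Nt; rewrite distrC; apply: le_lt_trans (iterate_limit nu t x w) _.
have := hN t Nt; rewrite ltr_pdivlMr ?ltr0n// mulrC; apply: le_lt_trans.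
by rewrite ler_wpM2r ?undecided_ge0// ler_nat.
Qed.

Lemma iterate_step (nu : probability configZ R) t k x (w : {ffun 'I_k -> B}) :
  pr (iterate nu t.+1) [set eta | win k x eta = w] =
  \sum_u pr (iterate nu t) [set eta | win k.+2 (x - 1) eta = u] * transition p q upd u w.
Proof.
rewrite (iterate_marginal upd Plaw) /=; apply: eq_bigr => u _.
by rewrite (iterate_marginal upd Plaw).
Qed.

Theorem label_driven_ergodic : ergodic (@Pca R B 3 [tuple -1; 0; 1] rl).
Proof.
exists limit_law; split.
(* The one-step recursion for window probabilities is a finite sum, so it passes to the limit along
   the iterates of the limit law. *)
- apply: (win_image rlE Plaw) => k x w.
  have h1 : pr (iterate limit_law t.+1) [set eta | win k x eta = w] @[t --> \oo] -->
      pr limit_law [set eta | win k x eta = w].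
    by have := @iterate_cvg limit_law k x w; rewrite -cvg_shiftS.
  have h2 : pr (iterate limit_law t.+1) [set eta | win k x eta = w] @[t --> \oo] -->
      \sum_u pr limit_law [set eta | win k.+2 (x - 1) eta = u] * transition p q upd u w.
    under eq_fun do rewrite iterate_step.
    by apply: cvg_big => [|u _]; [exact: add_continuous|apply: cvgMr_tmp; exact: iterate_cvg].
  by rewrite -(cvg_lim (@Rhausdorff R) h1) (cvg_lim (@Rhausdorff R) h2).
- move=> mu' smu' B' mB'; apply: probability_unique mB' => k x w.
  (* A stationary law has constant window probabilities along its iterates, and these converge to
     those of [limit_law]. *)
  have e' t k' x' (w' : {ffun 'I_k' -> B}) : pr (iterate mu' t) [set eta | win k' x' eta = w'] =
      pr mu' [set eta | win k' x' eta = w'].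
    elim: t k' x' w' => [//|t IHt] k' x' w'; rewrite iterate_step.
    rewrite (image_win rlE smu'); apply: eq_bigr => u _; congr (_ * _); exact: IHt.
  have := @iterate_cvg mu' k x w; under eq_fun do rewrite e'.
  by move=> h; rewrite -(cvg_lim (@Rhausdorff R) h) (cvg_lim (@Rhausdorff R) (cvg_cst _)).
- move=> nu; exists (iterate nu); split=> //.
  + by move=> t; apply: (win_image rlE Plaw) => k x w; exact: iterate_step.
  + by apply: cvg_weakly_win => k x w; exact: iterate_cvg.
Qed.
End Ergodicity.

(** * The two PCAs of the theorem as label-driven systems *)

Definition upd2 (l : label) (a b c : bool) : bool :=
  match l with Trap => false | Target => true | Open => ~~ [|| a, b | c] end.

Lemma upd2_refines l a b c (a' b' c' : bool) : refines id a a' -> refines id b b' ->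
  refines id c c' -> refines id (upd3 l a b c) (upd2 l a' b' c').
Proof.
case: l => //=; move: a b c a' b' c'.
by move=> [[]|] [[]|] [[]|] [] [] [] /= h1 h2 h3; rewrite /nor3 //=; congruence.
Qed.

Lemma tuple3_eq (A : eqType) (a : 3.-tuple A) :
  a = [tuple tnth a ord0; tnth a (inord 1); tnth a (inord 2)].
Proof.
apply: eq_from_tnth => i; rewrite [in RHS](tnth_nth (tnth a ord0)).
by case: i => -[|[|[|//]]] ilt /=; congr tnth; apply: val_inj; rewrite /= ?inordK.
Qed.

Lemma G_rule (R : realType) (p q : R) a b : rule (p := G p q) a b =
  site_law p q upd2 (tnth a ord0) (tnth a (inord 1)) (tnth a (inord 2)) b.
Proof.
rewrite /= {1}[a]tuple3_eq /site_law big_mkcond big_label /= -val_eqE /=.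
move: b; case: (tnth a ord0) (tnth a (inord 1)) (tnth a (inord 2)) => [] [] [] [] /=; ring.
Qed.

Lemma Ghat_rule (R : realType) (p q : R) a b : rule (p := Ghat p q) a b =
  site_law p q upd3 (tnth a ord0) (tnth a (inord 1)) (tnth a (inord 2)) b.
Proof.
rewrite /= {1 2}[a]tuple3_eq /site_law big_mkcond big_label /= -val_eqE /= !inE.
by move: b; case: (tnth a ord0) (tnth a (inord 1)) (tnth a (inord 2)) => [[]|] [[]|] [[]|] [[]|] /=;
  rewrite /nor3 /=; ring.
Qed.

Theorem theorem2p6 (R : realType) (p q : R)
    (hp : 0 <= p <= 1) (hq : 0 <= q <= 1) (hpq : 0 < p + q <= 1) :
  [/\ ergodic (G p q),
      ergodic (Ghat p q)
    & forall P : probability labeling R,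
        has_product_law (fun _ : vertex => label_mass p q) P ->
        forall v : vertex,
          measurable [set lab : labeling | class_D Out_V4 lab v] /\
          P [set lab : labeling | class_D Out_V4 lab v] = 0%E].
Proof.
have /andP[p0 _] := hp; have /andP[q0 _] := hq; have /andP[pq0 pq1] := hpq.
have [P Plaw] := iid_labels_exist p0 q0 pq1.
split.
- exact: (label_driven_ergodic p0 q0 pq0 pq1 upd2_refines (@G_rule R p q) Plaw).
- exact: (label_driven_ergodic p0 q0 pq0 pq1 upd3_refines (@Ghat_rule R p q) Plaw).
- by move=> Q Qlaw v; exact: (draw_null v p0 q0 pq0 pq1 Qlaw).
Qed.
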